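(* For every $p\in\{0,1,2,\dots\}$ there is an $f\in C^p(\mathbb T)$ that cannot be written as $f=g+h$ (on $\mathbb T$) for any $g\in A^p(D)$ and any $h\in A^p_0(\hat{\mathbb C}\setminus \overline D)$.
   Context: $D$ is the open unit disc in $\mathbb C$, $\mathbb T=\partial D$, $\hat{\mathbb C}=\mathbb C\cup\{\infty\}$. For $p\in\{0,1,2,\dots\}$: $C^{p}(\mathbb T)$ is the space of $f:\mathbb T\to\mathbb C$ such that $\theta\mapsto f(e^{i\theta})$ is $p$ times continuously differentiable. $A^{p}(D)$ is the space of holomorphic functions on $D$ whose derivatives $f^{(l)}$, $0\le l\le p$, extend continuously to $\overline D$. $A_0^{p}(\hat{\mathbb C}\setminus\overline D)$ is the space of functions $f$ holomorphic on $\mathbb C\setminus\overline D$ whose derivatives $f^{(l)}$, $0\le l\le p$, extend continuously to $\mathbb C\setminus D$, with $\lim_{z\to\infty}f(z)=0$. Elements of $A^p(D)$ and $A_0^p(\hat{\mathbb C}\setminus\overline D)$ are regarded as functions on $\mathbb T$ via restriction of the continuous extension. *)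

(* Defs.v *)
From Stdlib Require Import Reals.
From Coquelicot Require Import Coquelicot.
Open Scope R_scope.

(* Functions on a subset of C are total functions C -> C of which only the
   values on that subset matter. *)

(* fl is an l-th derivative of f on U.  Meaningful for U open: the values of f
   and fl outside U are irrelevant. With K = C this is the complex derivative,
   with K = R the derivative with respect to a real variable. *)
Fixpoint nth_derivative_on {K : AbsRing} {V : NormedModule K} (U : K -> Prop)
    (l : nat) (f fl : K -> V) : Prop :=
  match l with
  | O => forall x, U x -> fl x = f x
  | S l' => exists f' : K -> V,
      (forall x, U x -> is_derive f x (f' x)) /\ nth_derivative_on U l' f' fl
  end.

Definition unit_circle (z : C) : Prop := Cmod z = 1.
Definition unit_disc (z : C) : Prop := Cmod z < 1.
Definition closed_unit_disc (z : C) : Prop := Cmod z <= 1.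
Definition exterior (z : C) : Prop := 1 < Cmod z.
Definition closed_exterior (z : C) : Prop := 1 <= Cmod z.

Definition expi (t : R) : C := (cos t, sin t).

Definition Cp_circle (p : nat) (f : C -> C) : Prop :=
  exists k : R -> C,
    nth_derivative_on (K := R_AbsRing) (V := C_R_NormedModule)
      (fun _ => True) p (fun t => f (expi t)) k
    /\ forall t : R, continuous k t.

Definition holomorphic_on (U : C -> Prop) (f : C -> C) : Prop :=
  forall z, U z -> ex_derive (K := C_AbsRing) (V := C_NormedModule) f z.

Definition continuous_extension (U W : C -> Prop) (f F : C -> C) : Prop :=
  continuous_on W F /\ forall z, U z -> F z = f z.

Definition holomorphic_Cp (p : nat) (U W : C -> Prop) (f : C -> C) : Prop :=
  holomorphic_on U f
  /\ forall l : nat, (l <= p)%nat ->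
       exists fl Fl : C -> C,
         nth_derivative_on (K := C_AbsRing) (V := C_NormedModule) U l f fl
         /\ continuous_extension U W fl Fl.

Definition lim_infty_zero (f : C -> C) : Prop :=
  forall eps : R, 0 < eps ->
    exists M : R, forall z : C, M < Cmod z -> Cmod (f z) < eps.

Definition Ap_disc (p : nat) (g : C -> C) : Prop :=
  holomorphic_Cp p unit_disc closed_unit_disc g.

Definition A0p_exterior (p : nat) (h : C -> C) : Prop :=
  holomorphic_Cp p exterior closed_exterior h /\ lim_infty_zero h.

(* Main.v *)
(** The function [f] is a [p]-fold periodic antiderivative of the continuous odd
function [u], where [u t = 1 / (1 - ln (sin t))] on (0, PI), whose harmonic
conjugate is unbounded near [t = 0].  Suppose [f = G + H] on the circle.  The
boundary function of [G] is [p] times continuously differentiable in [t]; let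
[k] be its [p]-th derivative and [M] a bound of |k|.  By Cauchy's theorem [k] has
no negative Fourier coefficients and [u - k] only negative ones, so, writing
[q = r * exp (i t)], the integral of [u / (1 - conj q)] is the integral of
[k / (1 - conj q)], which is that of [k] against the Poisson kernel
[1 / (1 - conj q) + q / (1 - q)], hence at most [2 PI M].  Its imaginary part, up
to sign the integral of [u t * r sin t / (1 - 2 r cos t + r^2)], is however at
least [(r / 3) * ln (1 - ln (1 - r))], which tends to infinity as [r] tends to 1. *)

Require Import Defs.
From Stdlib Require Import Reals ZArith Lra Lia ClassicalEpsilon.
From Coquelicot Require Import Coquelicot.
Open Scope R_scope.

(** * Goursat's theorem for closed real one-forms on a rectangle *)

(** Why this [u]: for t beyond 1 - r the kernel r sin t / (1 - 2 r cos t + r^2) is comparable to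
    1/t, so continuity of [u] at 0 is not enough to bound the integral; a Dini condition would be.
    The modulus 1 / (1 - ln t) tends to 0, yet dt / (t (1 - ln t)) = d(- ln (1 - ln t)) has infinite
    integral at 0. Oddness makes [u] and the kernel agree in sign, so nothing cancels, and gives [u]
    mean zero, without which it has no periodic antiderivative.

    General p reduces to p = 0 by differentiating in t: the Fourier coefficient of index n is
    multiplied by i n, so vanishing coefficients stay zero. Pairing with a Cauchy kernel at r < 1
    needs only geometric series, never the convergence of a Fourier series.

    Two obstacles shape the rest. Smoothness of [g] is given inside the disc, whereas [k] lives on
    its boundary, so [k] arises as a limit of derivatives along smaller circles. And holomorphic
    means merely complex differentiable, so Cauchy's theorem needs Goursat's bisection; with z = exp
    (x + i y) an annulus unrolls to a rectangle, the only shape required. *)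

Definition boundary_integral (P Q : R -> R -> R) (a b c d : R) : R :=
  RInt (fun x => P x c - P x d) a b + RInt (fun y => Q b y - Q a y) c d.

(** The shared [m] is both the y-derivative of P and the x-derivative of Q: it says that the form P
    dx + Q dy, whose counterclockwise circulation is [boundary_integral], is closed at the point. No
    continuity of the partial derivatives is asked. *)
Definition closed_form_at (P Q : R -> R -> R) (x y : R) : Prop :=
  exists px m qy,
    differentiable_pt_lim P x y px m /\ differentiable_pt_lim Q x y m qy.

Definition closed_form_on (P Q : R -> R -> R) (a b c d : R) : Prop :=
  forall x y, a <= x <= b -> c <= y <= d -> closed_form_at P Q x y.

Lemma continuity_2d_pt_continuous_l (f : R -> R -> R) (x y : R) :
  continuity_2d_pt f x y -> continuous (fun u => f u y) x.
Proof.
intros H; apply continuity_pt_filterlim; intros eps Heps.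
destruct (H (mkposreal eps Heps)) as [delta Hd].
exists delta; split; [apply cond_pos|].
intros u [_ Hu]; apply Hd; [exact Hu|rewrite Rminus_eq_0, Rabs_R0; apply cond_pos].
Qed.

Lemma continuity_2d_pt_continuous_r (f : R -> R -> R) (x y : R) :
  continuity_2d_pt f x y -> continuous (fun v => f x v) y.
Proof.
intros H; apply continuity_pt_filterlim; intros eps Heps.
destruct (H (mkposreal eps Heps)) as [delta Hd].
exists delta; split; [apply cond_pos|].
intros v [_ Hv]; apply Hd; [rewrite Rminus_eq_0, Rabs_R0; apply cond_pos|exact Hv].
Qed.

Lemma differentiable_pt_lim_continuity (f : R -> R -> R) (x y lx ly : R) :
  differentiable_pt_lim f x y lx ly -> continuity_2d_pt f x y.
Proof. intros H; apply differentiable_continuity_pt; exists lx, ly; exact H. Qed.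

Lemma ex_RInt_continuous_le (f : R -> R) (a b : R) :
  a <= b -> (forall x, a <= x <= b -> continuous f x) -> ex_RInt f a b.
Proof.
intros Hab Hf.
apply (ex_RInt_continuous (V := R_CompleteNormedModule)).
rewrite Rmin_left, Rmax_right by assumption; exact Hf.
Qed.

Lemma closed_form_on_ex_RInt_l P Q a b c d a' b' y :
  closed_form_on P Q a b c d -> a <= a' -> a' <= b' -> b' <= b -> c <= y <= d ->
  ex_RInt (fun x => P x y) a' b'.
Proof.
intros H ? ? ? ?.
apply ex_RInt_continuous_le; [assumption|]; intros x Hx.
destruct (H x y) as (px & m & qy & HP & _); [lra|lra|].
apply (continuity_2d_pt_continuous_l P), (differentiable_pt_lim_continuity _ _ _ _ _ HP).
Qed.

Lemma closed_form_on_ex_RInt_r P Q a b c d x c' d' :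
  closed_form_on P Q a b c d -> c <= c' -> c' <= d' -> d' <= d -> a <= x <= b ->
  ex_RInt (fun y => Q x y) c' d'.
Proof.
intros H ? ? ? ?.
apply ex_RInt_continuous_le; [assumption|]; intros y Hy.
destruct (H x y) as (px & m & qy & _ & HQ); [lra|lra|].
apply (continuity_2d_pt_continuous_r Q), (differentiable_pt_lim_continuity _ _ _ _ _ HQ).
Qed.

Lemma RInt_Rminus (f g : R -> R) (a b : R) :
  ex_RInt f a b -> ex_RInt g a b ->
  RInt (fun x => f x - g x) a b = RInt f a b - RInt g a b.
Proof. exact (RInt_minus (V := R_CompleteNormedModule) f g a b). Qed.

Lemma ex_RInt_Rminus (f g : R -> R) (a b : R) :
  ex_RInt f a b -> ex_RInt g a b -> ex_RInt (fun x => f x - g x) a b.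
Proof. exact (ex_RInt_minus (V := R_NormedModule) f g a b). Qed.

Lemma RInt_Rplus_Chasles (f : R -> R) (a b c : R) :
  ex_RInt f a b -> ex_RInt f b c -> RInt f a b + RInt f b c = RInt f a c.
Proof. exact (RInt_Chasles (V := R_CompleteNormedModule) f a b c). Qed.

(** The common side x = m is traversed once in each direction and cancels. *)
Lemma boundary_integral_split_l P Q a m b c d :
  closed_form_on P Q a b c d -> a <= m <= b -> c <= d ->
  boundary_integral P Q a b c d =
  boundary_integral P Q a m c d + boundary_integral P Q m b c d.
Proof.
intros H Hm Hcd; unfold boundary_integral.
assert (EP : forall y a' b', c <= y <= d -> a <= a' -> a' <= b' -> b' <= b ->
  ex_RInt (fun x => P x y) a' b').
{ intros; apply (closed_form_on_ex_RInt_l P Q a b c d); assumption. }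
assert (EQ : forall x, a <= x <= b -> ex_RInt (fun y => Q x y) c d).
{ intros; apply (closed_form_on_ex_RInt_r P Q a b c d); lra || assumption. }
rewrite <- (RInt_Rplus_Chasles (fun x => P x c - P x d) a m b)
  by (apply ex_RInt_Rminus; apply EP; lra).
rewrite (RInt_Rminus (Q b) (Q a)), (RInt_Rminus (Q m) (Q a)), (RInt_Rminus (Q b) (Q m))
  by (apply EQ; lra); ring.
Qed.

Lemma boundary_integral_split_r P Q a b c m d :
  closed_form_on P Q a b c d -> a <= b -> c <= m <= d ->
  boundary_integral P Q a b c d =
  boundary_integral P Q a b c m + boundary_integral P Q a b m d.
Proof.
intros H Hab Hm; unfold boundary_integral.
assert (EP : forall y, c <= y <= d -> ex_RInt (fun x => P x y) a b).
{ intros; apply (closed_form_on_ex_RInt_l P Q a b c d); lra || assumption. }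
assert (EQ : forall x c' d', a <= x <= b -> c <= c' -> c' <= d' -> d' <= d ->
  ex_RInt (fun y => Q x y) c' d').
{ intros; apply (closed_form_on_ex_RInt_r P Q a b c d); assumption. }
rewrite <- (RInt_Rplus_Chasles (fun y => Q b y - Q a y) c m d)
  by (apply ex_RInt_Rminus; apply EQ; lra).
rewrite (RInt_Rminus (fun x => P x c) (fun x => P x d)),
  (RInt_Rminus (fun x => P x c) (fun x => P x m)),
  (RInt_Rminus (fun x => P x m) (fun x => P x d)) by (apply EP; lra); ring.
Qed.

Lemma RInt_near_const (f : R -> R) (a b k e : R) :
  a <= b -> ex_RInt f a b -> (forall x, a <= x <= b -> Rabs (f x - k) <= e) ->
  Rabs (RInt f a b - k * (b - a)) <= e * (b - a).
Proof.
intros Hab Hf He.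
assert (Hc : RInt (fun _ => k) a b = k * (b - a)).
{ rewrite (RInt_const (V := R_CompleteNormedModule)).
  unfold scal; simpl; unfold mult; simpl; ring. }
rewrite <- Hc.
assert (Hm := RInt_minus (V := R_CompleteNormedModule) f (fun _ => k) a b Hf (ex_RInt_const _ _ _)).
change (RInt f a b - RInt (fun _ => k) a b) with (minus (RInt f a b) (RInt (fun _ => k) a b)).
rewrite <- Hm.
rewrite Rmult_comm.
apply (abs_RInt_le_const (fun x => minus (f x) k)); [assumption| |exact He].
apply (ex_RInt_minus (V := R_NormedModule)); [exact Hf|apply ex_RInt_const].
Qed.

Lemma nested_intervals_inhabited (a b : nat -> R) :
  (forall n, a n <= a (S n)) -> (forall n, b (S n) <= b n) ->
  (forall n, a n <= b n) -> exists x, forall n, a n <= x <= b n.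
Proof.
intros Ha Hb Hab.
assert (Ham : forall n k, a n <= a (n + k)%nat).
{ intros n k; induction k as [|k IH]; [rewrite Nat.add_0_r; lra|].
  rewrite Nat.add_succ_r; specialize (Ha (n + k)%nat); lra. }
assert (Hbm : forall n k, b (n + k)%nat <= b n).
{ intros n k; induction k as [|k IH]; [rewrite Nat.add_0_r; lra|].
  rewrite Nat.add_succ_r; specialize (Hb (n + k)%nat); lra. }
assert (Hnm : forall n m, a n <= b m).
{ intros n m; specialize (Ham n m); specialize (Hbm m n).
  rewrite Nat.add_comm in Hbm; specialize (Hab (n + m)%nat); lra. }
destruct (completeness (fun x => exists n, x = a n)) as [x [Hx1 Hx2]].
- exists (b O); intros x [n ->]; apply Hnm.
- exists (a O), O; reflexivity.
- exists x; intros n; split; [apply Hx1; exists n; reflexivity|].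
  apply Hx2; intros y [m ->]; apply Hnm.
Qed.

Record rect := Rect { xmin : R; xmax : R; ymin : R; ymax : R }.

Definition rect_integral (P Q : R -> R -> R) (r : rect) : R :=
  boundary_integral P Q (xmin r) (xmax r) (ymin r) (ymax r).

(** Nesting and halved sides are all that the limit argument needs, so the position of [s] inside
    [r] is left free. *)
Definition quarter (r s : rect) : Prop :=
  xmin r <= xmin s <= xmax s /\ xmax s <= xmax r /\
  ymin r <= ymin s <= ymax s /\ ymax s <= ymax r /\
  xmax s - xmin s = (xmax r - xmin r) / 2 /\
  ymax s - ymin s = (ymax r - ymin r) / 2.

Lemma closed_form_on_sub P Q a b c d a' b' c' d' :
  closed_form_on P Q a b c d -> a <= a' -> b' <= b -> c <= c' -> d' <= d ->
  closed_form_on P Q a' b' c' d'.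
Proof. intros H ? ? ? ? x y ? ?; apply H; lra. Qed.

(** The four circulations add up to the whole one, so they cannot all be smaller than a quarter of
    it in absolute value. The result is a sigma type so that the choice can be iterated as a
    function. *)
Lemma exists_large_quarter P Q (r : rect) :
  xmin r <= xmax r -> ymin r <= ymax r ->
  closed_form_on P Q (xmin r) (xmax r) (ymin r) (ymax r) ->
  {s | quarter r s /\
    Rabs (rect_integral P Q r) <= 4 * Rabs (rect_integral P Q s)}.
Proof.
intros Hx Hy H.
destruct r as [a b c d]; unfold rect_integral; simpl in *.
set (m := (a + b) / 2); set (k := (c + d) / 2).
assert (Hm : a <= m <= b) by (unfold m; lra).
assert (Hk : c <= k <= d) by (unfold k; lra).
assert (E : boundary_integral P Q a b c d =
  (boundary_integral P Q a m c k + boundary_integral P Q a m k d) +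
  (boundary_integral P Q m b c k + boundary_integral P Q m b k d)).
{ rewrite <- 2 boundary_integral_split_r;
    try lra; try (apply (closed_form_on_sub P Q a b c d); lra || assumption).
  apply boundary_integral_split_l; assumption || lra. }
assert (Q1 : quarter (Rect a b c d) (Rect a m c k)) by (unfold quarter, m, k in *; simpl; lra).
assert (Q2 : quarter (Rect a b c d) (Rect a m k d)) by (unfold quarter, m, k in *; simpl; lra).
assert (Q3 : quarter (Rect a b c d) (Rect m b c k)) by (unfold quarter, m, k in *; simpl; lra).
assert (Q4 : quarter (Rect a b c d) (Rect m b k d)) by (unfold quarter, m, k in *; simpl; lra).
destruct (Rle_dec (Rabs (boundary_integral P Q a b c d))
  (4 * Rabs (boundary_integral P Q a m c k))) as [L1|L1];
  [exists (Rect a m c k); split; assumption|].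
destruct (Rle_dec (Rabs (boundary_integral P Q a b c d))
  (4 * Rabs (boundary_integral P Q a m k d))) as [L2|L2];
  [exists (Rect a m k d); split; assumption|].
destruct (Rle_dec (Rabs (boundary_integral P Q a b c d))
  (4 * Rabs (boundary_integral P Q m b c k))) as [L3|L3];
  [exists (Rect m b c k); split; assumption|].
exists (Rect m b k d); split; [assumption|]; simpl.
revert L1 L2 L3; rewrite E.
intros L1 L2 L3; apply Rnot_le_lt in L1, L2, L3.
revert L1 L2 L3; unfold Rabs; repeat destruct Rcase_abs; lra.
Qed.

Lemma quarter_sequence P Q (r : rect) :
  xmin r <= xmax r -> ymin r <= ymax r ->
  closed_form_on P Q (xmin r) (xmax r) (ymin r) (ymax r) ->
  exists s : nat -> rect, s O = r /\
    forall n, quarter (s n) (s (S n)) /\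
      Rabs (rect_integral P Q (s n)) <= 4 * Rabs (rect_integral P Q (s (S n))).
Proof.
intros Hx Hy H.
set (good := fun r => xmin r <= xmax r /\ ymin r <= ymax r /\
  closed_form_on P Q (xmin r) (xmax r) (ymin r) (ymax r)).
(* The recursion runs on rectangles bundled with their invariants, since a next rectangle exists
   only under them. *)
assert (step : forall r : {r | good r}, {s : {r | good r} |
  quarter (proj1_sig r) (proj1_sig s) /\
  Rabs (rect_integral P Q (proj1_sig r)) <= 4 * Rabs (rect_integral P Q (proj1_sig s))}).
{ intros [r0 (H1 & H2 & H3)]; simpl.
  destruct (exists_large_quarter P Q r0 H1 H2 H3) as [s [Hq Hs]].
  assert (Gs : good s).
  { unfold quarter in Hq; repeat split; try lra.
    apply (closed_form_on_sub _ _ _ _ _ _ _ _ _ _ H3); lra. }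
  exists (exist _ s Gs); split; assumption. }
assert (Gr : good r) by (repeat split; assumption).
set (s := fun n => Nat.iter n (fun r => proj1_sig (step r)) (exist _ r Gr)).
exists (fun n => proj1_sig (s n)); split; [reflexivity|].
intros n; exact (proj2_sig (step (s n))).
Qed.

(** An affine closed form has zero circulation, so only the first-order Taylor remainders
    contribute: they are at most eps times the size of the rectangle, integrated over sides of that
    size. *)
Lemma closed_form_small_rect P Q x0 y0 eps :
  closed_form_at P Q x0 y0 -> 0 < eps ->
  exists delta, 0 < delta /\ forall a b c d,
    a <= x0 <= b -> c <= y0 <= d -> (b - a) + (d - c) < delta ->
    closed_form_on P Q a b c d ->
    Rabs (boundary_integral P Q a b c d) <= eps * ((b - a) + (d - c)) ^ 2.
Proof.
intros (px & m & qy & HP & HQ) Heps.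
assert (Heps2 : 0 < eps / 2) by lra.
destruct (HP (mkposreal _ Heps2)) as [d1 Hd1].
destruct (HQ (mkposreal _ Heps2)) as [d2 Hd2].
simpl in Hd1, Hd2.
exists (Rmin d1 d2); split; [apply Rmin_pos; apply cond_pos|].
intros a b c d Hx Hy HL H.
set (L := b - a + (d - c)) in *.
assert (HLd1 : L < d1) by (eapply Rlt_le_trans; [exact HL|apply Rmin_l]).
assert (HLd2 : L < d2) by (eapply Rlt_le_trans; [exact HL|apply Rmin_r]).
assert (Habs : forall x, a <= x <= b -> Rabs (x - x0) <= L).
{ intros x ?; unfold L; apply Rabs_le; lra. }
assert (Habs' : forall y, c <= y <= d -> Rabs (y - y0) <= L).
{ intros y ?; unfold L; apply Rabs_le; lra. }
assert (BP : forall x y, a <= x <= b -> c <= y <= d ->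
  Rabs (P x y - P x0 y0 - (px * (x - x0) + m * (y - y0))) <= eps / 2 * L).
{ intros x y Hx' Hy'; specialize (Habs x Hx'); specialize (Habs' y Hy').
  eapply Rle_trans; [apply Hd1; lra|].
  apply Rmult_le_compat_l; [lra|]; apply Rmax_lub; assumption. }
assert (BQ : forall x y, a <= x <= b -> c <= y <= d ->
  Rabs (Q x y - Q x0 y0 - (m * (x - x0) + qy * (y - y0))) <= eps / 2 * L).
{ intros x y Hx' Hy'; specialize (Habs x Hx'); specialize (Habs' y Hy').
  eapply Rle_trans; [apply Hd2; lra|].
  apply Rmult_le_compat_l; [lra|]; apply Rmax_lub; assumption. }
(* In P x c - P x d the terms in x - x0 cancel and m * (c - d) remains. The main term here is the
   opposite of the one in [I2], which is where closedness enters. *)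
assert (I1 : Rabs (RInt (fun x => P x c - P x d) a b - m * (c - d) * (b - a)) <=
  eps * L * (b - a)).
{ apply RInt_near_const; [lra| |].
  - apply ex_RInt_Rminus; apply (closed_form_on_ex_RInt_l P Q a b c d); lra || assumption.
  - intros x Hx'.
    assert (B1 := BP x c Hx' ltac:(lra)); assert (B2 := BP x d Hx' ltac:(lra)).
    apply Rabs_le_between in B1, B2; apply Rabs_le_between; lra. }
assert (I2 : Rabs (RInt (fun y => Q b y - Q a y) c d - m * (b - a) * (d - c)) <=
  eps * L * (d - c)).
{ apply RInt_near_const; [lra| |].
  - apply ex_RInt_Rminus; apply (closed_form_on_ex_RInt_r P Q a b c d); lra || assumption.
  - intros y Hy'.
    assert (B1 := BQ b y ltac:(lra) Hy'); assert (B2 := BQ a y ltac:(lra) Hy').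
    apply Rabs_le_between in B1, B2; apply Rabs_le_between; lra. }
unfold boundary_integral.
replace (eps * L ^ 2) with (eps * L * (b - a) + eps * L * (d - c)) by (unfold L; ring).
apply Rabs_le_between in I1, I2; apply Rabs_le_between; lra.
Qed.

(** After n bisections the circulation has shrunk at most by 4^n, while near the common point it is
    at most eps times the squared size, that is eps * L^2 / 4^n. The powers of 4 cancel and eps is
    arbitrary. *)
Theorem goursat_rectangle P Q a b c d :
  a <= b -> c <= d -> closed_form_on P Q a b c d ->
  boundary_integral P Q a b c d = 0.
Proof.
intros Hab Hcd H.
destruct (quarter_sequence P Q (Rect a b c d) Hab Hcd H) as [s [Hs0 Hs]].
assert (Hin : forall n, a <= xmin (s n) /\ xmin (s n) <= xmax (s n) /\ xmax (s n) <= b /\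
  c <= ymin (s n) /\ ymin (s n) <= ymax (s n) /\ ymax (s n) <= d).
{ induction n as [|n IH]; [rewrite Hs0; simpl; lra|].
  destruct (Hs n) as [Hq _]; unfold quarter in Hq; lra. }
destruct (nested_intervals_inhabited (fun n => xmin (s n)) (fun n => xmax (s n)))
  as [x0 Hx0]; try (intros n; destruct (Hs n) as [Hq _]; specialize (Hin n); unfold quarter in Hq; lra).
destruct (nested_intervals_inhabited (fun n => ymin (s n)) (fun n => ymax (s n)))
  as [y0 Hy0]; try (intros n; destruct (Hs n) as [Hq _]; specialize (Hin n); unfold quarter in Hq; lra).
set (L := (b - a) + (d - c)).
assert (HL : 0 <= L) by (unfold L; lra).
assert (Hside : forall n, (xmax (s n) - xmin (s n)) + (ymax (s n) - ymin (s n)) = L / 2 ^ n).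
{ induction n as [|n IH]; [rewrite Hs0; unfold L; simpl; field|].
  destruct (Hs n) as [Hq _]; unfold quarter in Hq.
  replace (L / 2 ^ S n) with ((L / 2 ^ n) / 2) by (simpl; field; apply pow_nonzero; lra).
  rewrite <- IH; lra. }
assert (Hlow : forall n, Rabs (boundary_integral P Q a b c d) <=
  (2 ^ n) ^ 2 * Rabs (rect_integral P Q (s n))).
{ induction n as [|n IH].
  - rewrite Hs0; unfold rect_integral; simpl; lra.
  - destruct (Hs n) as [_ Hn]; eapply Rle_trans; [exact IH|].
    replace ((2 ^ S n) ^ 2) with ((2 ^ n) ^ 2 * 4) by (simpl; ring).
    rewrite Rmult_assoc; apply Rmult_le_compat_l; [apply pow2_ge_0|exact Hn]. }
assert (Hcf : closed_form_at P Q x0 y0).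
{ specialize (Hx0 O); specialize (Hy0 O); rewrite Hs0 in Hx0, Hy0; apply H; assumption. }
assert (Hbound : forall eps, 0 < eps -> Rabs (boundary_integral P Q a b c d) <= eps * L ^ 2).
{ intros eps Heps.
  destruct (closed_form_small_rect P Q x0 y0 eps Hcf Heps) as [delta [Hdelta Hsmall]].
  (* Dividing by L + 1 rather than L covers the rectangle reduced to a point. *)
  destruct (pow_lt_1_zero (1 / 2) ltac:(rewrite Rabs_pos_eq; lra) (delta / (L + 1)))
    as [N HN]; [apply Rdiv_lt_0_compat; lra|].
  specialize (HN N (le_n N)).
  rewrite Rabs_pos_eq in HN by (apply pow_le; lra).
  assert (H2N : 0 < 2 ^ N) by (apply pow_lt; lra).
  assert (HLN : L / 2 ^ N < delta).
  { replace (1 / 2) with (/ 2) in HN by lra; rewrite pow_inv in HN.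
    apply Rle_lt_trans with ((L + 1) * / 2 ^ N).
    - apply Rmult_le_compat_r; [left; apply Rinv_0_lt_compat; assumption|lra].
    - apply (Rmult_lt_compat_l (L + 1)) in HN; [|lra].
      replace ((L + 1) * (delta / (L + 1))) with delta in HN by (field; lra); exact HN. }
  eapply Rle_trans; [apply (Hlow N)|].
  apply Rle_trans with ((2 ^ N) ^ 2 * (eps * (L / 2 ^ N) ^ 2)).
  - apply Rmult_le_compat_l; [apply pow2_ge_0|].
    rewrite <- (Hside N); apply Hsmall; [apply Hx0|apply Hy0|rewrite Hside; exact HLN|].
    apply (closed_form_on_sub _ _ _ _ _ _ _ _ _ _ H); apply Hin.
  - right; field; lra. }
destruct (Req_dec (boundary_integral P Q a b c d) 0) as [E|E]; [exact E|exfalso].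
apply Rabs_pos_lt in E.
assert (HL2 : 0 <= L ^ 2) by apply pow2_ge_0.
(* With this eps the bound reads |I| <= |I| * L^2 / (2 (L^2 + 1)), which is less than |I|. *)
specialize (Hbound (Rabs (boundary_integral P Q a b c d) / (2 * (L ^ 2 + 1)))).
assert (Hpos : 0 < Rabs (boundary_integral P Q a b c d) / (2 * (L ^ 2 + 1)))
  by (apply Rdiv_lt_0_compat; lra).
specialize (Hbound Hpos).
assert (EE : Rabs (boundary_integral P Q a b c d) =
  Rabs (boundary_integral P Q a b c d) / (2 * (L ^ 2 + 1)) * (2 * (L ^ 2 + 1)))
  by (field; lra).
nra.
Qed.

(** * Complex derivatives in polar coordinates *)

Notation is_Cderive := (is_derive (K := C_AbsRing) (V := C_NormedModule)).

(** The product rule of the library is for the codomain [AbsRing_NormedModule C_AbsRing],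
which differs from [C_NormedModule] by its uniform structure. *)
Lemma is_Cderive_ring (f : C -> C) (z d : C) :
  is_Cderive f z d <->
  is_derive (K := C_AbsRing) (V := AbsRing_NormedModule C_AbsRing) f z d.
Proof.
split; intros [[L1 L2 L3] H]; split; try exact H; (split; [exact L1|exact L2|exact L3]).
Qed.

Lemma is_Cderive_mult (f g : C -> C) (z df dg : C) :
  is_Cderive f z df -> is_Cderive g z dg ->
  is_Cderive (fun w => f w * g w)%C z (df * g z + f z * dg)%C.
Proof.
rewrite 3 is_Cderive_ring; intros Hf Hg.
apply (is_derive_mult (K := C_AbsRing) f g z df dg Hf Hg Cmult_comm).
Qed.

Lemma is_Cderive_id (z : C) : is_Cderive (fun w => w) z (RtoC 1).
Proof. apply is_Cderive_ring; apply (is_derive_id (K := C_AbsRing)). Qed.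

Lemma is_Cderive_const (c z : C) : is_Cderive (fun _ => c) z (RtoC 0).
Proof. apply (is_derive_const (K := C_AbsRing) (V := C_NormedModule)). Qed.

Lemma is_Cderive_plus (f g : C -> C) (z df dg : C) :
  is_Cderive f z df -> is_Cderive g z dg ->
  is_Cderive (fun w => f w + g w)%C z (df + dg)%C.
Proof. apply (is_derive_plus (K := C_AbsRing) (V := C_NormedModule)). Qed.

Lemma is_Cderive_eps (f : C -> C) (z d : C) :
  is_Cderive f z d <->
  forall eps : posreal, exists delta : posreal, forall w, Cmod (w - z)%C < delta ->
    Cmod (f w - f z - (w - z) * d)%C <= eps * Cmod (w - z)%C.
Proof.
split.
- intros [_ H] eps.
  destruct (H z (fun P HP => HP) eps) as [delta Hd].
  exists delta; intros w Hw; exact (Hd w Hw).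
- intros H; split.
  + apply (is_linear_scal_l (K := C_AbsRing) (V := C_NormedModule)).
  (* The differential is stated at every limit x of the filter of neighbourhoods of z; by separation
     x is z. *)
  + intros x Hx; apply (is_filter_lim_locally_unique (V := AbsRing_NormedModule C_AbsRing)) in Hx.
    subst x.
    intros eps; destruct (H eps) as [delta Hd].
    exists delta; intros w Hw; exact (Hd w Hw).
Qed.

Lemma is_Cderive_unique (f : C -> C) (z d d' : C) :
  is_Cderive f z d -> is_Cderive f z d' -> d = d'.
Proof. intros H H'; rewrite <- (is_C_derive_unique f z d H); apply is_C_derive_unique, H'. Qed.

Lemma is_Cderive_inv (z : C) : z <> 0 -> is_Cderive Cinv z (- / (z * z))%C.
Proof.
intros Hz; apply is_Cderive_eps; intros eps.
assert (Hm : 0 < Cmod z) by (apply Cmod_gt_0; exact Hz).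
(* The remainder of the first-order expansion is exactly (w - z)^2 / (w z^2). The first radius keeps
   |w| above |z| / 2, the second then makes |w - z| at most eps |w| |z|^2. *)
assert (Hd : 0 < Rmin (Cmod z / 2) (eps * (Cmod z) ^ 3 / 2)).
{ apply Rmin_pos; [lra|]; apply Rdiv_lt_0_compat; [|lra].
  apply Rmult_lt_0_compat; [apply cond_pos|apply pow_lt, Hm]. }
exists (mkposreal _ Hd); simpl; intros w Hw.
assert (Hw1 : Cmod (w - z)%C < Cmod z / 2) by (eapply Rlt_le_trans; [exact Hw|apply Rmin_l]).
assert (Hw2 : Cmod (w - z)%C < eps * (Cmod z) ^ 3 / 2) by (eapply Rlt_le_trans; [exact Hw|apply Rmin_r]).
assert (Hwz : Cmod z / 2 < Cmod w).
{ assert (T := Cmod_triangle w (z - w)%C).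
  replace (w + (z - w))%C with z in T by ring.
  replace (z - w)%C with (- (w - z))%C in T by ring; rewrite Cmod_opp in T; lra. }
assert (Hw0 : w <> 0) by (apply Cmod_gt_0; lra).
replace (/ w - / z - (w - z) * - / (z * z))%C with ((w - z) * ((w - z) * / (w * (z * z))))%C
  by (field; split; assumption).
rewrite 2 Cmod_mult, Cmod_inv, 2 Cmod_mult by (repeat apply Cmult_neq_0; assumption).
rewrite Rmult_comm; apply Rmult_le_compat_r; [apply Cmod_ge_0|].
assert (Hden : 0 < Cmod w * (Cmod z * Cmod z)).
{ apply Rmult_lt_0_compat; [lra|]; apply Rmult_lt_0_compat; assumption. }
apply Rmult_le_reg_r with (Cmod w * (Cmod z * Cmod z)); [exact Hden|].
rewrite Rmult_assoc, Rinv_l, Rmult_1_r by lra.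
left; eapply Rlt_le_trans; [exact Hw2|].
replace (eps * Cmod z ^ 3 / 2) with (eps * (Cmod z / 2 * (Cmod z * Cmod z))) by (simpl; field).
apply Rmult_le_compat_l; [left; apply cond_pos|].
apply Rmult_le_compat_r; [nra|lra].
Qed.

Definition Cdifferentiable (f : C -> C) (z : C) : Prop := exists d, is_Cderive f z d.

Lemma Cdifferentiable_mult (f g : C -> C) (z : C) :
  Cdifferentiable f z -> Cdifferentiable g z -> Cdifferentiable (fun w => f w * g w)%C z.
Proof.
intros [df Hf] [dg Hg]; eexists; apply is_Cderive_mult; [exact Hf|exact Hg].
Qed.

Lemma Cdifferentiable_pow (f : C -> C) (z : C) (n : nat) :
  Cdifferentiable f z -> Cdifferentiable (fun w => f w ^ n)%C z.
Proof.
intros Hf; induction n as [|n IH].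
- exists (RtoC 0); exact (is_Cderive_const (RtoC 1) z).
- apply (Cdifferentiable_mult f (fun w => f w ^ n)%C); assumption.
Qed.

Lemma Cmod_lt_pair (u v e : R) : Rabs u < e / 2 -> Rabs v < e / 2 -> Cmod (u, v) < e.
Proof.
intros Hu Hv.
replace ((u, v) : C) with (RtoC u + Ci * RtoC v)%C
  by (apply injective_projections; simpl; ring).
eapply Rle_lt_trans; [apply Cmod_triangle|].
rewrite Cmod_mult, 2 Cmod_R.
replace (Cmod Ci) with 1; [lra|].
unfold Cmod, Ci; simpl; replace (0 * (0 * 1) + 1 * (1 * 1)) with 1 by ring.
symmetry; apply sqrt_1.
Qed.

Lemma Rabs_fst_le_Cmod (z : C) : Rabs (fst z) <= Cmod z.
Proof. eapply Rle_trans; [apply Rmax_l|apply Rmax_Cmod]. Qed.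

Lemma Rabs_snd_le_Cmod (z : C) : Rabs (snd z) <= Cmod z.
Proof. eapply Rle_trans; [apply Rmax_r|apply Rmax_Cmod]. Qed.

Lemma Cmod_le_pair (u v : R) : Cmod (u, v) <= 2 * Rmax (Rabs u) (Rabs v).
Proof.
eapply Rle_trans; [apply Cmod_2Rmax|]; simpl.
apply Rmult_le_compat_r; [eapply Rle_trans; [apply Rabs_pos|apply Rmax_l]|].
assert (S := sqrt_le_1_alt 2 (2 * 2) ltac:(lra)); rewrite sqrt_square in S; lra.
Qed.

(** Cauchy-Riemann: multiplication by d is a real 2 x 2 matrix whose first row is (Re d, - Im d). *)
Lemma is_Cderive_differentiable_fst (f : C -> C) (x y : R) (d : C) :
  is_Cderive f (x, y) d ->
  differentiable_pt_lim (fun u v => fst (f (u, v))) x y (fst d) (- snd d).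
Proof.
rewrite is_Cderive_eps; intros H eps.
assert (He : 0 < eps / 2) by (apply Rdiv_lt_0_compat; [apply cond_pos|lra]).
destruct (H (mkposreal _ He)) as [delta Hd]; simpl in Hd.
assert (He' : 0 < delta / 2) by (apply Rdiv_lt_0_compat; [apply cond_pos|lra]).
exists (mkposreal _ He'); simpl; intros u v Hu Hv.
assert (E : Cminus (u, v) (x, y) = (u - x, v - y)) by (apply injective_projections; simpl; ring).
specialize (Hd (u, v)); rewrite E in Hd.
specialize (Hd (Cmod_lt_pair _ _ _ Hu Hv)).
assert (B := Rle_trans _ _ _ (Rabs_fst_le_Cmod _) Hd); simpl in B.
replace (fst (f (u, v)) - fst (f (x, y)) - (fst d * (u - x) + - snd d * (v - y)))
  with (fst (f (u, v)) + - fst (f (x, y)) + - ((u - x) * fst d - (v - y) * snd d)) by ring.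
eapply Rle_trans; [exact B|].
assert (B2 := Cmod_le_pair (u - x) (v - y)).
apply Rmult_le_compat_l with (r := eps / 2) in B2; lra.
Qed.

(** The second row of that matrix, obtained because the imaginary part of f is the real part of - i
    f. *)
Lemma is_Cderive_differentiable_snd (f : C -> C) (x y : R) (d : C) :
  is_Cderive f (x, y) d ->
  differentiable_pt_lim (fun u v => snd (f (u, v))) x y (snd d) (fst d).
Proof.
intros H.
assert (H' := is_Cderive_mult _ _ _ _ _ (is_Cderive_const (- Ci)%C (x, y)) H).
apply is_Cderive_differentiable_fst in H'; simpl in H'.
replace (snd d) with (0 * fst (f (x, y)) - 0 * snd (f (x, y)) + (- (0) * fst d - - (1) * snd d)) by ring.
replace (fst d) with (- (0 * snd (f (x, y)) + 0 * fst (f (x, y)) + (- (0) * snd d + - (1) * fst d)))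
  at 2 by ring.
eapply differentiable_pt_lim_ext; [|exact H'].
exists (mkposreal 1 Rlt_0_1); intros; ring.
Qed.

Definition circ (r t : R) : C := (r * cos t, r * sin t).

Lemma circ_differentiable_fst (x y : R) :
  differentiable_pt_lim (fun u v => fst (circ (exp u) v)) x y
    (exp x * cos y) (- (exp x * sin y)).
Proof.
apply filterdiff_differentiable_pt_lim; simpl.
eapply filterdiff_ext_lin.
- apply (filterdiff_mult_fct (fun p : R * R => exp (fst p)) (fun p : R * R => cos (snd p))).
  + intros; apply Rmult_comm.
  + apply (filterdiff_comp' (@fst R R) exp); [apply filterdiff_linear, is_linear_fst|].
    apply is_derive_exp.
  + apply (filterdiff_comp' (@snd R R) cos); [apply filterdiff_linear, is_linear_snd|].
    apply is_derive_cos.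
- intros [u v]; simpl; unfold plus, scal, mult; simpl; unfold mult; simpl; ring.
Qed.

Lemma circ_differentiable_snd (x y : R) :
  differentiable_pt_lim (fun u v => snd (circ (exp u) v)) x y
    (exp x * sin y) (exp x * cos y).
Proof.
apply filterdiff_differentiable_pt_lim; simpl.
eapply filterdiff_ext_lin.
- apply (filterdiff_mult_fct (fun p : R * R => exp (fst p)) (fun p : R * R => sin (snd p))).
  + intros; apply Rmult_comm.
  + apply (filterdiff_comp' (@fst R R) exp); [apply filterdiff_linear, is_linear_fst|].
    apply is_derive_exp.
  + apply (filterdiff_comp' (@snd R R) sin); [apply filterdiff_linear, is_linear_snd|].
    apply is_derive_sin.
- intros [u v]; simpl; unfold plus, scal, mult; simpl; unfold mult; simpl; ring.
Qed.

(** Imaginary part of [f dz / z] in the coordinates [z = exp (x + i y)]. *)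
Lemma polar_closed_form (f : C -> C) (x y : R) :
  Cdifferentiable f (circ (exp x) y) ->
  closed_form_at (fun u v => snd (f (circ (exp u) v)))
    (fun u v => fst (f (circ (exp u) v))) x y.
Proof.
intros [d Hd].
assert (HU := differentiable_pt_lim_comp _ _ _ x y _ _ _ _ _ _
  (is_Cderive_differentiable_fst _ _ _ _ Hd)
  (circ_differentiable_fst x y) (circ_differentiable_snd x y)).
assert (HV := differentiable_pt_lim_comp _ _ _ x y _ _ _ _ _ _
  (is_Cderive_differentiable_snd _ _ _ _ Hd)
  (circ_differentiable_fst x y) (circ_differentiable_snd x y)).
simpl in HU, HV.
do 3 eexists; split; [exact HV|].
(* The Cauchy-Riemann equations for f (exp (x + i y)): the y-derivative of its imaginary part is the
   x-derivative of its real part. *)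
match goal with |- differentiable_pt_lim _ _ _ ?m _ =>
  replace m with (fst d * (exp x * cos y) + - snd d * (exp x * sin y)) by ring end.
exact HU.
Qed.

(** Taken componentwise so that Goursat's theorem for real forms applies to each component;
    [is_RInt_CRInt] identifies it with the vector-valued integral. *)
Definition CRInt (f : R -> C) (a b : R) : C :=
  (RInt (fun t => fst (f t)) a b, RInt (fun t => snd (f t)) a b).

Lemma circ_Cmod (r t : R) : 0 <= r -> Cmod (circ r t) = r.
Proof.
intros Hr; unfold Cmod, circ; simpl.
replace (r * cos t * (r * cos t * 1) + r * sin t * (r * sin t * 1))
  with (r * r * (Rsqr (sin t) + Rsqr (cos t))) by (unfold Rsqr; ring).
rewrite sin2_cos2, Rmult_1_r; apply sqrt_square, Hr.
Qed.

(** In logarithmic coordinates the annulus is the rectangle between ln r and ln s in x and between -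
    PI and PI in y; its vertical sides are the two circles. *)
Lemma RInt_fst_circ_const (f : C -> C) (r s : R) :
  0 < r <= s -> (forall z, r <= Cmod z <= s -> Cdifferentiable f z) ->
  RInt (fun t => fst (f (circ s t))) (- PI) PI = RInt (fun t => fst (f (circ r t))) (- PI) PI.
Proof.
intros [Hr Hrs] Hf.
assert (HPI : - PI <= PI) by (assert (H := PI_RGT_0); lra).
assert (Hln : ln r <= ln s) by (apply ln_le; assumption).
assert (H : closed_form_on (fun u v => snd (f (circ (exp u) v)))
  (fun u v => fst (f (circ (exp u) v))) (ln r) (ln s) (- PI) PI).
{ intros x y Hx _; apply polar_closed_form, Hf.
  rewrite circ_Cmod by (left; apply exp_pos).
  rewrite <- (exp_ln r), <- (exp_ln s) by lra.
  assert (forall u v, u <= v -> exp u <= exp v).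
  { intros u v [Huv|Huv]; [left; apply exp_increasing, Huv|rewrite Huv; right; reflexivity]. }
  split; auto; apply H; lra. }
assert (G := goursat_rectangle _ _ _ _ _ _ Hln HPI H).
unfold boundary_integral in G; rewrite 2 exp_ln in G by lra.
rewrite (RInt_ext _ (fun _ => 0)) in G.
- rewrite (RInt_const (V := R_CompleteNormedModule)) in G.
  change (scal (ln s - ln r) 0) with ((ln s - ln r) * 0) in G.
  rewrite RInt_Rminus in G; [lra| |].
  + rewrite <- (exp_ln s) by lra.
    apply (closed_form_on_ex_RInt_r _ _ _ _ _ _ (ln s) _ _ H); lra.
  + rewrite <- (exp_ln r) by lra.
    apply (closed_form_on_ex_RInt_r _ _ _ _ _ _ (ln r) _ _ H); lra.
(* The two horizontal sides lie over the same slit along the negative axis, so their contributions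
   cancel. *)
- intros x _; unfold circ; rewrite cos_neg, sin_neg, sin_PI.
  replace (exp x * - 0) with (exp x * 0) by ring; apply Rminus_eq_0.
Qed.

Lemma CRInt_circ_const (f : C -> C) (r s : R) :
  0 < r <= s -> (forall z, r <= Cmod z <= s -> Cdifferentiable f z) ->
  CRInt (fun t => f (circ s t)) (- PI) PI = CRInt (fun t => f (circ r t)) (- PI) PI.
Proof.
intros Hrs Hf; apply injective_projections; simpl.
- apply RInt_fst_circ_const; assumption.
- assert (H := RInt_fst_circ_const (fun z => - Ci * f z)%C r s Hrs).
  rewrite (RInt_ext (fun t => snd (f (circ s t))) (fun t => fst (- Ci * f (circ s t))%C))
    by (intros; simpl; ring).
  rewrite (RInt_ext (fun t => snd (f (circ r t))) (fun t => fst (- Ci * f (circ r t))%C))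
    by (intros; simpl; ring).
  apply H; intros z Hz.
  apply (Cdifferentiable_mult (fun _ => - Ci)%C f); [|apply Hf, Hz].
  exists (RtoC 0); apply is_Cderive_const.
Qed.

(** * Integrals of complex-valued functions of a real variable *)

Definition Ccontinuous (f : R -> C) : Prop :=
  forall t, continuous (fun s => fst (f s)) t /\ continuous (fun s => snd (f s)) t.

Lemma continuous_Ccontinuous (f : R -> C) :
  (forall t, continuous f t) <-> Ccontinuous f.
Proof.
split; intros H t.
- split.
  + apply (continuous_comp f fst); [apply H|destruct (f t); apply continuous_fst].
  + apply (continuous_comp f snd); [apply H|destruct (f t); apply continuous_snd].
- destruct (H t) as [H1 H2].
  apply filterlim_locally; intros eps.
  assert (L1 := proj1 (filterlim_locally _ _) H1 eps).
  assert (L2 := proj1 (filterlim_locally _ _) H2 eps).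
  generalize (filter_and _ _ L1 L2); apply filter_imp.
  intros s [B1 B2]; split; assumption.
Qed.

Lemma Ccontinuous_ext (f g : R -> C) :
  (forall t, f t = g t) -> Ccontinuous f -> Ccontinuous g.
Proof.
intros E H t; destruct (H t) as [H1 H2]; split.
- apply (continuous_ext (fun s => fst (f s))); [intros; rewrite E; reflexivity|exact H1].
- apply (continuous_ext (fun s => snd (f s))); [intros; rewrite E; reflexivity|exact H2].
Qed.

Lemma Ccontinuous_const (c : C) : Ccontinuous (fun _ => c).
Proof. intros t; split; apply continuous_const. Qed.

Lemma Ccontinuous_plus (f g : R -> C) :
  Ccontinuous f -> Ccontinuous g -> Ccontinuous (fun t => f t + g t)%C.
Proof.
intros Hf Hg t; destruct (Hf t), (Hg t); split;
  apply (continuous_plus (V := R_NormedModule)); assumption.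
Qed.

Lemma Ccontinuous_mult (f g : R -> C) :
  Ccontinuous f -> Ccontinuous g -> Ccontinuous (fun t => f t * g t)%C.
Proof.
intros Hf Hg t; destruct (Hf t), (Hg t); split.
- apply (continuous_minus (V := R_NormedModule));
    apply (continuous_mult (K := R_AbsRing)); assumption.
- apply (continuous_plus (V := R_NormedModule));
    apply (continuous_mult (K := R_AbsRing)); assumption.
Qed.

Lemma Ccontinuous_pow (f : R -> C) (n : nat) :
  Ccontinuous f -> Ccontinuous (fun t => f t ^ n)%C.
Proof.
intros Hf; induction n as [|n IH]; [apply (Ccontinuous_const (RtoC 1))|].
apply (Ccontinuous_mult f (fun t => f t ^ n)%C); assumption.
Qed.

Lemma Ccontinuous_conj (f : R -> C) :
  Ccontinuous f -> Ccontinuous (fun t => Cconj (f t)).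
Proof.
intros Hf t; destruct (Hf t); split; [assumption|].
apply (continuous_opp (V := R_NormedModule)); assumption.
Qed.

Lemma Ccontinuous_inv (f : R -> C) :
  Ccontinuous f -> (forall t, f t <> 0) -> Ccontinuous (fun t => / f t)%C.
Proof.
intros Hf H0 t; destruct (Hf t) as [H1 H2].
assert (N0 : fst (f t) ^ 2 + snd (f t) ^ 2 <> 0).
{ intros E; apply (H0 t).
  assert (B1 := pow2_ge_0 (fst (f t))); assert (B2 := pow2_ge_0 (snd (f t))).
  apply injective_projections; simpl; nra. }
assert (N : continuous (fun s => / (fst (f s) ^ 2 + snd (f s) ^ 2)) t).
{ apply continuous_Rinv_comp; [|exact N0].
  apply (continuous_ext (fun s => fst (f s) * fst (f s) + snd (f s) * snd (f s)));
    [intros s; simpl; rewrite 2 Rmult_1_r; reflexivity|].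
  apply (continuous_plus (V := R_NormedModule) (fun s => fst (f s) * fst (f s)));
    apply (continuous_mult (K := R_AbsRing)); assumption. }
split.
- apply (continuous_mult (K := R_AbsRing)); assumption.
- apply (continuous_mult (K := R_AbsRing)); [|assumption].
  apply (continuous_opp (V := R_NormedModule)); assumption.
Qed.

Lemma Ccontinuous_RtoC (f : R -> R) :
  (forall t, continuous f t) -> Ccontinuous (fun t => RtoC (f t)).
Proof. intros Hf t; split; [apply Hf|apply continuous_const]. Qed.

Lemma Ccontinuous_circ (r : R) : Ccontinuous (circ r).
Proof.
intros t; split; apply (ex_derive_continuous (V := R_NormedModule)); unfold circ; simpl;
  auto_derive; exact I.
Qed.

Lemma ex_RInt_Cfst (f : R -> C) a b : Ccontinuous f -> ex_RInt (fun t => fst (f t)) a b.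
Proof.
intros Hf; apply (ex_RInt_continuous (V := R_CompleteNormedModule)); intros t _; apply Hf.
Qed.

Lemma ex_RInt_Csnd (f : R -> C) a b : Ccontinuous f -> ex_RInt (fun t => snd (f t)) a b.
Proof.
intros Hf; apply (ex_RInt_continuous (V := R_CompleteNormedModule)); intros t _; apply Hf.
Qed.

Lemma CRInt_ext (f g : R -> C) a b : (forall t, f t = g t) -> CRInt f a b = CRInt g a b.
Proof.
intros E; unfold CRInt; f_equal; apply RInt_ext; intros; rewrite E; reflexivity.
Qed.

Lemma is_RInt_CRInt (f : R -> C) a b :
  Ccontinuous f -> is_RInt (V := C_R_NormedModule) f a b (CRInt f a b).
Proof.
intros Hf; apply (is_RInt_fct_extend_pair (U := R_NormedModule) (V := R_NormedModule)).
- apply (RInt_correct (V := R_CompleteNormedModule)), ex_RInt_Cfst, Hf.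
- apply (RInt_correct (V := R_CompleteNormedModule)), ex_RInt_Csnd, Hf.
Qed.

Lemma is_RInt_CRInt_unique (f : R -> C) a b l :
  is_RInt (V := C_R_NormedModule) f a b l -> CRInt f a b = l.
Proof.
intros H; apply injective_projections; simpl; apply is_RInt_unique.
- apply (is_RInt_fct_extend_fst (U := R_NormedModule) (V := R_NormedModule) f a b l H).
- apply (is_RInt_fct_extend_snd (U := R_NormedModule) (V := R_NormedModule) f a b l H).
Qed.

Lemma CRInt_plus (f g : R -> C) a b :
  Ccontinuous f -> Ccontinuous g ->
  CRInt (fun t => f t + g t)%C a b = (CRInt f a b + CRInt g a b)%C.
Proof.
intros Hf Hg; apply is_RInt_CRInt_unique.
apply (is_RInt_plus (V := C_R_NormedModule) f g); apply is_RInt_CRInt; assumption.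
Qed.

Lemma RInt_lin_comb (f g : R -> R) (x y a b : R) :
  ex_RInt f a b -> ex_RInt g a b ->
  RInt (fun t => x * f t + y * g t) a b = x * RInt f a b + y * RInt g a b.
Proof.
intros Hf Hg.
rewrite (RInt_plus (V := R_CompleteNormedModule) (fun t => x * f t) (fun t => y * g t)).
- change plus with Rplus; f_equal; apply (RInt_scal (V := R_CompleteNormedModule)); assumption.
- apply (ex_RInt_scal (V := R_NormedModule)); assumption.
- apply (ex_RInt_scal (V := R_NormedModule)); assumption.
Qed.

Lemma CRInt_scal (c : C) (f : R -> C) a b :
  Ccontinuous f -> CRInt (fun t => c * f t)%C a b = (c * CRInt f a b)%C.
Proof.
intros Hf; assert (H1 := ex_RInt_Cfst f a b Hf); assert (H2 := ex_RInt_Csnd f a b Hf).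
apply injective_projections; simpl.
- rewrite (RInt_ext _ (fun t => fst c * fst (f t) + - snd c * snd (f t)))
    by (intros; simpl; ring).
  rewrite RInt_lin_comb by assumption; ring.
- rewrite RInt_lin_comb by assumption; ring.
Qed.

Lemma CRInt_opp (f : R -> C) a b :
  Ccontinuous f -> CRInt (fun t => - f t)%C a b = (- CRInt f a b)%C.
Proof.
intros Hf; replace (- CRInt f a b)%C with (- (1) * CRInt f a b)%C by ring.
rewrite <- CRInt_scal by assumption; apply CRInt_ext; intros; ring.
Qed.

Lemma CRInt_minus (f g : R -> C) a b :
  Ccontinuous f -> Ccontinuous g ->
  CRInt (fun t => f t - g t)%C a b = (CRInt f a b - CRInt g a b)%C.
Proof.
intros Hf Hg; unfold Cminus; rewrite <- CRInt_opp by assumption.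
apply CRInt_plus; [assumption|].
apply (Ccontinuous_ext (fun t => - (1) * g t)%C); [intros; ring|].
apply Ccontinuous_mult; [apply Ccontinuous_const|assumption].
Qed.

Lemma CRInt_const (c : C) a b : CRInt (fun _ => c) a b = (RtoC (b - a) * c)%C.
Proof.
apply injective_projections; simpl;
  rewrite (RInt_const (V := R_CompleteNormedModule));
  unfold scal; simpl; unfold mult; simpl; ring.
Qed.

Lemma CRInt_conj (f : R -> C) a b :
  Ccontinuous f -> CRInt (fun t => Cconj (f t)) a b = Cconj (CRInt f a b).
Proof.
intros Hf; apply injective_projections; simpl; [reflexivity|].
apply (RInt_opp (V := R_CompleteNormedModule)), ex_RInt_Csnd, Hf.
Qed.

Lemma Cmod_CRInt_le (f : R -> C) (g : R -> R) a b :
  a <= b -> Ccontinuous f -> ex_RInt g a b ->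
  (forall t, a <= t <= b -> Cmod (f t) <= g t) -> Cmod (CRInt f a b) <= RInt g a b.
Proof.
intros Hab Hf Hg Hfg; rewrite Cmod_norm.
apply (norm_RInt_le (V := C_R_NormedModule) f g a b); [assumption| | |].
- intros t Ht; rewrite <- Cmod_norm; apply Hfg, Ht.
- apply is_RInt_CRInt, Hf.
- apply (RInt_correct (V := R_CompleteNormedModule)), Hg.
Qed.

Lemma Cmod_CRInt_le_const (f : R -> C) (M a b : R) :
  a <= b -> Ccontinuous f -> (forall t, a <= t <= b -> Cmod (f t) <= M) ->
  Cmod (CRInt f a b) <= (b - a) * M.
Proof.
intros Hab Hf HM.
replace ((b - a) * M) with (RInt (fun _ => M) a b) by apply (RInt_const (V := R_CompleteNormedModule)).
apply Cmod_CRInt_le; try assumption; apply ex_RInt_const.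
Qed.

Lemma CRInt_derive (f df : R -> C) a b :
  (forall t, is_derive (V := C_R_NormedModule) f t (df t)) -> Ccontinuous df ->
  CRInt df a b = (f b - f a)%C.
Proof.
intros Hf Hdf; apply is_RInt_CRInt_unique.
apply (is_RInt_derive (V := C_R_CompleteNormedModule) f df); intros t _; [apply Hf|].
revert t; apply continuous_Ccontinuous, Hdf.
Qed.

(** * Mean values over circles *)

Lemma continuous_on_Cmod (D : C -> Prop) (F : C -> C) (z : C) (eps : R) :
  continuous_on D F -> D z -> 0 < eps ->
  exists delta, 0 < delta /\
    forall w, D w -> Cmod (w - z)%C < delta -> Cmod (F w - F z)%C < eps.
Proof.
intros HF Hz Heps.
assert (L : locally (F z) (fun y => Cmod (y - F z)%C < eps)).
{ assert (Heps2 : 0 < eps / 2) by lra.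
  exists (mkposreal _ Heps2); intros y [B1 B2].
  apply Cmod_lt_pair; [exact B1|exact B2]. }
destruct (HF z Hz _ L) as [delta Hd].
exists delta; split; [apply cond_pos|]; intros w Hw Hwz.
apply Hd; [|exact Hw]; split.
- eapply Rle_lt_trans; [apply (Rabs_fst_le_Cmod (w - z)%C)|exact Hwz].
- eapply Rle_lt_trans; [apply (Rabs_snd_le_Cmod (w - z)%C)|exact Hwz].
Qed.

Lemma continuous_on_Cmult (D : C -> Prop) (f g : C -> C) :
  continuous_on D f -> continuous_on D g -> continuous_on D (fun z => f z * g z)%C.
Proof.
intros Hf Hg z Hz.
refine (filterlim_comp_2 f g Cmult (Hf z Hz) (Hg z Hz) _).
(* [locally_C] passes between neighbourhoods for the product structure of C and those for the
   modulus, for which multiplication is known to be continuous. *)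
intros P HP; apply locally_C in HP.
destruct (filterlim_mult (K := C_AbsRing) (f z) (g z) P HP) as [Q R HQ HR H].
exists Q R; [apply locally_C, HQ|apply locally_C, HR|exact H].
Qed.

Lemma continuous_on_Cplus (D : C -> Prop) (f g : C -> C) :
  continuous_on D f -> continuous_on D g -> continuous_on D (fun z => f z + g z)%C.
Proof.
intros Hf Hg z Hz.
refine (filterlim_comp_2 f g Cplus (Hf z Hz) (Hg z Hz) _).
apply (filterlim_plus (V := C_NormedModule)).
Qed.

Lemma continuous_on_const (D : C -> Prop) (c : C) : continuous_on D (fun _ : C => c).
Proof. intros z _; apply filterlim_const. Qed.

Lemma continuous_on_id (D : C -> Prop) : continuous_on D (fun z : C => z).
Proof. intros z _ P HP; change (locally z (fun w => D w -> P w)).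
revert HP; apply filter_imp; trivial. Qed.

Lemma continuous_on_Cpow (D : C -> Prop) (f : C -> C) (n : nat) :
  continuous_on D f -> continuous_on D (fun z => f z ^ n)%C.
Proof.
intros Hf; induction n as [|n IH]; [apply (continuous_on_const D (RtoC 1))|].
apply (continuous_on_Cmult D f (fun z => f z ^ n)%C); assumption.
Qed.

(** Continuity of F holds only relative to D. Passing the radius through a map c that keeps every
    circle inside D turns it into joint continuity on the whole plane of parameters; c is later
    [clamp] or [Rmax 1]. *)
Lemma circ_continuity_2d (D : C -> Prop) (F : C -> C) (c : R -> R) (r t eps : R) :
  continuous_on D F -> (forall x, continuous c x) -> (forall r t, D (circ (c r) t)) ->
  0 < eps ->
  locally_2d (fun u v => Cmod (F (circ (c u) v) - F (circ (c r) t))%C < eps) r t.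
Proof.
intros HF Hc HD Heps.
destruct (continuous_on_Cmod D F _ eps HF (HD r t) Heps) as [d [Hd HdF]].
assert (C1 : continuity_2d_pt (fun u v => c u * cos v) r t).
{ apply continuity_2d_pt_mult; apply continuity_1d_2d_pt_comp.
  - apply continuity_pt_filterlim, Hc.
  - apply continuity_2d_pt_id1.
  - apply continuity_cos.
  - apply continuity_2d_pt_id2. }
assert (C2 : continuity_2d_pt (fun u v => c u * sin v) r t).
{ apply continuity_2d_pt_mult; apply continuity_1d_2d_pt_comp.
  - apply continuity_pt_filterlim, Hc.
  - apply continuity_2d_pt_id1.
  - apply continuity_sin.
  - apply continuity_2d_pt_id2. }
assert (Hd2 : 0 < d / 2) by lra.
generalize (locally_2d_and _ _ _ _ (C1 (mkposreal _ Hd2)) (C2 (mkposreal _ Hd2))).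
apply locally_2d_impl, locally_2d_forall; intros u v [B1 B2]; apply HdF; [apply HD|].
apply Cmod_lt_pair; [exact B1|exact B2].
Qed.

Lemma circ_continuity_2d_fst (D : C -> Prop) (F : C -> C) (c : R -> R) (r t : R) :
  continuous_on D F -> (forall x, continuous c x) -> (forall r t, D (circ (c r) t)) ->
  continuity_2d_pt (fun u v => fst (F (circ (c u) v))) r t.
Proof.
intros HF Hc HD eps; generalize (circ_continuity_2d D F c r t eps HF Hc HD (cond_pos eps)).
apply locally_2d_impl, locally_2d_forall; intros u v B.
eapply Rle_lt_trans; [apply (Rabs_fst_le_Cmod (_ - _)%C)|exact B].
Qed.

Lemma circ_continuity_2d_snd (D : C -> Prop) (F : C -> C) (c : R -> R) (r t : R) :
  continuous_on D F -> (forall x, continuous c x) -> (forall r t, D (circ (c r) t)) ->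
  continuity_2d_pt (fun u v => snd (F (circ (c u) v))) r t.
Proof.
intros HF Hc HD eps; generalize (circ_continuity_2d D F c r t eps HF Hc HD (cond_pos eps)).
apply locally_2d_impl, locally_2d_forall; intros u v B.
eapply Rle_lt_trans; [apply (Rabs_snd_le_Cmod (_ - _)%C)|exact B].
Qed.

Lemma Ccontinuous_on_circ (D : C -> Prop) (F : C -> C) (c : R -> R) (r : R) :
  continuous_on D F -> (forall x, continuous c x) -> (forall r t, D (circ (c r) t)) ->
  Ccontinuous (fun t => F (circ (c r) t)).
Proof.
intros HF Hc HD t; split.
- apply (continuity_2d_pt_continuous_r (fun u v => fst (F (circ (c u) v)))).
  apply (circ_continuity_2d_fst D); assumption.
- apply (continuity_2d_pt_continuous_r (fun u v => snd (F (circ (c u) v)))).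
  apply (circ_continuity_2d_snd D); assumption.
Qed.

Lemma CRInt_circ_continuous (D : C -> Prop) (F : C -> C) (c : R -> R) (r0 a b eps : R) :
  continuous_on D F -> (forall x, continuous c x) -> (forall r t, D (circ (c r) t)) ->
  a <= b -> 0 < eps ->
  exists delta, 0 < delta /\ forall r, Rabs (r - r0) < delta ->
    Cmod (CRInt (fun t => F (circ (c r) t)) a b -
          CRInt (fun t => F (circ (c r0) t)) a b)%C <= eps.
Proof.
intros HF Hc HD Hab Heps.
(* Half for each component; b - a + 1 instead of b - a allows a = b. *)
assert (He : 0 < eps / (b - a + 1) / 2).
{ apply Rdiv_lt_0_compat; [apply Rdiv_lt_0_compat|]; lra. }
destruct (uniform_continuity_2d (fun u v => fst (F (circ (c u) v))) (r0 - 1) (r0 + 1) a b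
  (fun x y _ _ => circ_continuity_2d_fst D F c x y HF Hc HD) (mkposreal _ He)) as [d1 Hd1].
destruct (uniform_continuity_2d (fun u v => snd (F (circ (c u) v))) (r0 - 1) (r0 + 1) a b
  (fun x y _ _ => circ_continuity_2d_snd D F c x y HF Hc HD) (mkposreal _ He)) as [d2 Hd2].
simpl in Hd1, Hd2.
assert (P1 := cond_pos d1); assert (P2 := cond_pos d2).
exists (Rmin 1 (Rmin d1 d2)); split; [repeat apply Rmin_pos; lra|].
intros r Hr.
assert (Hr1 : Rabs (r - r0) < 1) by (eapply Rlt_le_trans; [exact Hr|apply Rmin_l]).
assert (Hr2 : Rabs (r - r0) < Rmin d1 d2) by (eapply Rlt_le_trans; [exact Hr|apply Rmin_r]).
assert (Hr3 : Rabs (r - r0) < d1) by (eapply Rlt_le_trans; [exact Hr2|apply Rmin_l]).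
assert (Hr4 : Rabs (r - r0) < d2) by (eapply Rlt_le_trans; [exact Hr2|apply Rmin_r]).
apply Rabs_def2 in Hr1.
rewrite <- CRInt_minus by (apply (Ccontinuous_on_circ D); assumption).
apply Rle_trans with ((b - a) * (eps / (b - a + 1))).
- apply Cmod_CRInt_le_const; [assumption| |].
  + apply (Ccontinuous_ext (fun t => F (circ (c r) t) + - (1) * F (circ (c r0) t))%C); [intros; ring|].
    apply Ccontinuous_plus; [|apply Ccontinuous_mult; [apply Ccontinuous_const|]];
      apply (Ccontinuous_on_circ D); assumption.
  + intros t Ht; left; apply Cmod_lt_pair.
    * apply Hd1; try lra; rewrite Rminus_eq_0, Rabs_R0; lra.
    * apply Hd2; try lra; rewrite Rminus_eq_0, Rabs_R0; lra.
- apply Rle_trans with ((b - a + 1) * (eps / (b - a + 1))).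
  + apply Rmult_le_compat_r; [left; apply Rdiv_lt_0_compat|]; lra.
  + right; field; lra.
Qed.

Lemma Ceq_of_Cmod_le (u v : C) : (forall eps, 0 < eps -> Cmod (u - v)%C <= eps) -> u = v.
Proof.
intros H.
assert (E : Cmod (u - v)%C = 0).
{ apply Rle_antisym; [|apply Cmod_ge_0].
  apply Rnot_lt_le; intros L; specialize (H (Cmod (u - v)%C / 2) ltac:(lra)); lra. }
apply Cmod_eq_0 in E.
replace u with (u - v + v)%C by ring; rewrite E; ring.
Qed.

Lemma continuous_Rmax_l (a x : R) : continuous (Rmax a) x.
Proof.
apply continuity_pt_filterlim; intros eps Heps.
exists eps; split; [exact Heps|]; intros y [_ Hy].
eapply Rle_lt_trans; [|exact Hy]; simpl; unfold R_dist.
unfold Rmax, Rabs; repeat destruct Rle_dec; repeat destruct Rcase_abs; lra.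
Qed.

Lemma continuous_Rmin_l (a x : R) : continuous (Rmin a) x.
Proof.
apply continuity_pt_filterlim; intros eps Heps.
exists eps; split; [exact Heps|]; intros y [_ Hy].
eapply Rle_lt_trans; [|exact Hy]; simpl; unfold R_dist.
unfold Rmin, Rabs; repeat destruct Rle_dec; repeat destruct Rcase_abs; lra.
Qed.

(** Precomposing with [clamp] makes functions on the closed disc continuous in a
neighbourhood of the boundary radius, as [uniform_continuity_2d] requires. *)
Definition clamp (r : R) : R := Rmax 0 (Rmin 1 r).

Lemma clamp_id (r : R) : 0 <= r <= 1 -> clamp r = r.
Proof. intros Hr; unfold clamp; rewrite Rmin_right, Rmax_right; lra. Qed.

Lemma clamp_bounds (r : R) : 0 <= clamp r <= 1.
Proof. unfold clamp, Rmax, Rmin; repeat destruct Rle_dec; lra. Qed.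

Lemma clamp_continuous (r : R) : continuous clamp r.
Proof. apply (continuous_comp (Rmin 1) (Rmax 0)); [apply continuous_Rmin_l|apply continuous_Rmax_l]. Qed.

Lemma clamp_disc (r t : R) : closed_unit_disc (circ (clamp r) t).
Proof.
assert (B := clamp_bounds r); unfold closed_unit_disc; rewrite circ_Cmod; lra.
Qed.

Lemma Ccontinuous_disc (F : C -> C) (r : R) :
  continuous_on closed_unit_disc F -> 0 <= r <= 1 -> Ccontinuous (fun t => F (circ r t)).
Proof.
intros HF Hr; rewrite <- (clamp_id r Hr).
apply (Ccontinuous_on_circ _ _ _ _ HF clamp_continuous clamp_disc).
Qed.

Lemma CRInt_disc_continuous (F : C -> C) (r0 a b eps : R) :
  continuous_on closed_unit_disc F -> 0 <= r0 <= 1 -> a <= b -> 0 < eps ->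
  exists delta, 0 < delta /\ forall r, 0 <= r <= 1 -> Rabs (r - r0) < delta ->
    Cmod (CRInt (fun t => F (circ r t)) a b - CRInt (fun t => F (circ r0 t)) a b)%C <= eps.
Proof.
intros HF Hr0 Hab Heps.
destruct (CRInt_circ_continuous _ _ _ r0 a b eps HF clamp_continuous clamp_disc Hab Heps)
  as [d [Hd H]].
exists d; split; [exact Hd|]; intros r Hr Hrd; specialize (H r Hrd).
rewrite (clamp_id r Hr), (clamp_id r0 Hr0) in H; exact H.
Qed.

Lemma Rmax_exterior (r t : R) : closed_exterior (circ (Rmax 1 r) t).
Proof.
assert (B := Rmax_l 1 r); unfold closed_exterior; rewrite circ_Cmod; lra.
Qed.

Lemma Ccontinuous_exterior (F : C -> C) (r : R) :
  continuous_on closed_exterior F -> 1 <= r -> Ccontinuous (fun t => F (circ r t)).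
Proof.
intros HF Hr; rewrite <- (Rmax_right 1 r Hr).
apply (Ccontinuous_on_circ _ _ _ _ HF (continuous_Rmax_l 1) Rmax_exterior).
Qed.

Lemma CRInt_exterior_continuous (F : C -> C) (a b eps : R) :
  continuous_on closed_exterior F -> a <= b -> 0 < eps ->
  exists delta, 0 < delta /\ forall r, 1 <= r < 1 + delta ->
    Cmod (CRInt (fun t => F (circ r t)) a b - CRInt (fun t => F (circ 1 t)) a b)%C <= eps.
Proof.
intros HF Hab Heps.
destruct (CRInt_circ_continuous _ _ _ 1 a b eps HF (continuous_Rmax_l 1) Rmax_exterior Hab Heps)
  as [d [Hd H]].
exists d; split; [exact Hd|]; intros r Hr.
specialize (H r ltac:(rewrite Rabs_pos_eq; lra)).
rewrite (Rmax_right 1 r), (Rmax_right 1 1) in H by lra; exact H.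
Qed.

(** The integral over the circle of radius r is constant for 0 < r < 1, and uniform continuity
    carries this value to r = 1 and to r = 0, where the integrand is constant. *)
Lemma disc_mean_value (F : C -> C) :
  continuous_on closed_unit_disc F -> (forall z, unit_disc z -> Cdifferentiable F z) ->
  CRInt (fun t => F (circ 1 t)) (- PI) PI = (RtoC (2 * PI) * F 0)%C.
Proof.
intros HF Hd.
assert (HPI := PI_RGT_0).
assert (E0 : CRInt (fun t => F (circ 0 t)) (- PI) PI = (RtoC (2 * PI) * F 0)%C).
{ rewrite (CRInt_ext _ (fun _ => F 0)), CRInt_const; [do 2 f_equal; ring|].
  intros t; f_equal; apply injective_projections; simpl; ring. }
rewrite <- E0; apply Ceq_of_Cmod_le; intros eps Heps.
destruct (CRInt_disc_continuous F 0 (- PI) PI (eps / 2) HF) as [d0 [Hd0 H0]]; try lra.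
destruct (CRInt_disc_continuous F 1 (- PI) PI (eps / 2) HF) as [d1 [Hd1 H1]]; try lra.
(* The thresholds 1/2 ensure r <= s, so that the two interior circles bound an annulus. *)
set (r := Rmin (1 / 2) (d0 / 2)); set (s := Rmax (1 / 2) (1 - d1 / 2)).
assert (Hr : 0 < r <= 1 / 2 /\ r < d0).
{ unfold r, Rmin; destruct Rle_dec; lra. }
assert (Hs : 1 / 2 <= s < 1 /\ 1 - d1 < s).
{ unfold s, Rmax; destruct Rle_dec; lra. }
specialize (H0 r ltac:(lra) ltac:(rewrite Rabs_pos_eq; lra)).
specialize (H1 s ltac:(lra) ltac:(rewrite Rabs_minus_sym, Rabs_pos_eq; lra)).
rewrite (CRInt_circ_const F r s) in H1;
  [|lra|intros z Hz; apply Hd; unfold unit_disc; lra].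
set (I1 := CRInt (fun t => F (circ 1 t)) (- PI) PI) in *.
set (I0 := CRInt (fun t => F (circ 0 t)) (- PI) PI) in *.
set (Ir := CRInt (fun t => F (circ r t)) (- PI) PI) in *.
replace (I1 - I0)%C with (- (Ir - I1) + (Ir - I0))%C by ring.
eapply Rle_trans; [apply Cmod_triangle|]; rewrite Cmod_opp; lra.
Qed.

(** The circle is pushed out to infinity. As the integral is against dt, that is dz / (i z), decay
    of F without any rate suffices. *)
Lemma exterior_mean_value (F : C -> C) :
  continuous_on closed_exterior F -> (forall z, exterior z -> Cdifferentiable F z) ->
  lim_infty_zero F ->
  CRInt (fun t => F (circ 1 t)) (- PI) PI = 0.
Proof.
intros HF Hd Hlim.
assert (HPI := PI_RGT_0).
apply Ceq_of_Cmod_le; intros eps Heps.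
destruct (CRInt_exterior_continuous F (- PI) PI (eps / 2) HF) as [d [Hd0 H1]]; try lra.
destruct (Hlim (eps / 2 / (2 * PI))) as [M HM]; [apply Rdiv_lt_0_compat; lra|].
set (r := 1 + d / 2); set (s := Rmax r (M + 1)).
assert (Hs : r <= s /\ M < s).
{ unfold s, Rmax; destruct Rle_dec; lra. }
specialize (H1 r ltac:(unfold r; lra)).
rewrite <- (CRInt_circ_const F r s) in H1;
  [|unfold r in *; lra|intros z Hz; apply Hd; unfold exterior, r in *; lra].
assert (H2 : Cmod (CRInt (fun t => F (circ s t)) (- PI) PI) <= (PI - - PI) * (eps / 2 / (2 * PI))).
{ apply Cmod_CRInt_le_const; [lra|apply Ccontinuous_exterior; [exact HF|unfold r in *; lra]|].
  intros t _; left; apply HM; rewrite circ_Cmod; unfold r in *; lra. }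
replace ((PI - - PI) * (eps / 2 / (2 * PI))) with (eps / 2) in H2 by (field; lra).
set (I1 := CRInt (fun t => F (circ 1 t)) (- PI) PI) in *.
set (Is := CRInt (fun t => F (circ s t)) (- PI) PI) in *.
replace (I1 - 0)%C with (- (Is - I1) + Is)%C by ring.
eapply Rle_trans; [apply Cmod_triangle|]; rewrite Cmod_opp; lra.
Qed.

(** * Boundary derivatives *)

Notation is_RCderive := (is_derive (K := R_AbsRing) (V := C_R_NormedModule)).

Lemma is_RCderive_components (f : R -> C) (t : R) (l : C) :
  is_RCderive f t l <->
  is_derive (fun s => fst (f s)) t (fst l) /\ is_derive (fun s => snd (f s)) t (snd l).
Proof.
split.
- intros H; split.
  + apply (filterdiff_comp' f (@fst R R) t (fun y => scal y l) (@fst R R)); [exact H|].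
    apply filterdiff_linear, is_linear_fst.
  + apply (filterdiff_comp' f (@snd R R) t (fun y => scal y l) (@snd R R)); [exact H|].
    apply filterdiff_linear, is_linear_snd.
- intros [[_ H1] [_ H2]]; split; [apply (is_linear_scal_l (V := C_R_NormedModule))|].
  intros x Hx eps.
  assert (He : 0 < eps / 2) by (apply Rdiv_lt_0_compat; [apply cond_pos|lra]).
  generalize (filter_and _ _ (H1 x Hx (mkposreal _ He)) (H2 x Hx (mkposreal _ He))).
  apply filter_imp; intros y [B1 B2].
  set (v := minus (minus (f y) (f x)) (scal (minus y x) l) : C).
  change (norm (V := C_R_NormedModule) v <= eps * norm (minus y x)).
  rewrite <- Cmod_norm, (surjective_pairing v).
  eapply Rle_trans; [apply Cmod_le_pair|].
  assert (B : Rmax (Rabs (fst v)) (Rabs (snd v)) <= eps / 2 * norm (minus y x)).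
  { apply Rmax_lub; [exact B1|exact B2]. }
  lra.
Qed.

Lemma is_RCderive_ext (f g : R -> C) (t : R) (l : C) :
  (forall s, f s = g s) -> is_RCderive f t l -> is_RCderive g t l.
Proof. apply (is_derive_ext (V := C_R_NormedModule)). Qed.

Lemma is_RCderive_unique (f : R -> C) (t : R) (l l' : C) :
  is_RCderive f t l -> is_RCderive f t l' -> l = l'.
Proof.
rewrite 2 is_RCderive_components; intros [H1 H2] [H1' H2'].
apply is_derive_unique in H1, H2, H1', H2'.
apply injective_projections; congruence.
Qed.

Lemma is_RCderive_plus (f g : R -> C) (t : R) (l m : C) :
  is_RCderive f t l -> is_RCderive g t m -> is_RCderive (fun s => f s + g s)%C t (l + m)%C.
Proof. apply (is_derive_plus (V := C_R_NormedModule)). Qed.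

Lemma is_RCderive_mult (f g : R -> C) (t : R) (l m : C) :
  is_RCderive f t l -> is_RCderive g t m ->
  is_RCderive (fun s => f s * g s)%C t (l * g t + f t * m)%C.
Proof.
rewrite 3 is_RCderive_components; intros [H1 H2] [H1' H2']; simpl; split.
- replace (fst l * fst (g t) - snd l * snd (g t) + (fst (f t) * fst m - snd (f t) * snd m))
    with (minus (plus (mult (fst l) (fst (g t))) (mult (fst (f t)) (fst m)))
      (plus (mult (snd l) (snd (g t))) (mult (snd (f t)) (snd m))))
    by (unfold minus, plus, opp, mult; simpl; ring).
  apply (is_derive_minus (V := R_NormedModule));
    apply (is_derive_mult (K := R_AbsRing)); assumption || apply Rmult_comm.
- replace (fst l * snd (g t) + snd l * fst (g t) + (fst (f t) * snd m + snd (f t) * fst m))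
    with (plus (plus (mult (fst l) (snd (g t))) (mult (fst (f t)) (snd m)))
      (plus (mult (snd l) (fst (g t))) (mult (snd (f t)) (fst m))))
    by (unfold minus, plus, opp, mult; simpl; ring).
  apply (is_derive_plus (V := R_NormedModule));
    apply (is_derive_mult (K := R_AbsRing)); assumption || apply Rmult_comm.
Qed.

Lemma is_RCderive_continuous (f df : R -> C) :
  (forall t, is_RCderive f t (df t)) -> Ccontinuous f.
Proof.
intros H; apply continuous_Ccontinuous; intros t.
apply (ex_derive_continuous (V := C_R_NormedModule)); exists (df t); apply H.
Qed.

Lemma is_RCderive_circ (r t : R) : is_RCderive (circ r) t (Ci * circ r t)%C.
Proof.
apply is_RCderive_components; unfold circ; simpl; split; auto_derive; trivial; ring.
Qed.

Lemma is_RCderive_along_circ (g : C -> C) (r t : R) (d : C) :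
  is_Cderive g (circ r t) d ->
  is_RCderive (fun s => g (circ r s)) t (Ci * circ r t * d)%C.
Proof.
intros H; apply is_RCderive_components.
assert (H1 : derivable_pt_lim (fun s => r * cos s) t (- (r * sin t))).
{ apply is_derive_Reals; auto_derive; trivial; ring. }
assert (H2 : derivable_pt_lim (fun s => r * sin s) t (r * cos t)).
{ apply is_derive_Reals; auto_derive; trivial; ring. }
split; apply is_derive_Reals.
- replace (fst (Ci * circ r t * d)%C) with (fst d * - (r * sin t) + - snd d * (r * cos t))
    by (simpl; ring).
  apply (derivable_pt_lim_comp_2d (fun u v => fst (g (u, v))) (fun s => r * cos s) (fun s => r * sin s));
    [apply is_Cderive_differentiable_fst|..]; assumption.
- replace (snd (Ci * circ r t * d)%C) with (snd d * - (r * sin t) + fst d * (r * cos t))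
    by (simpl; ring).
  apply (derivable_pt_lim_comp_2d (fun u v => snd (g (u, v))) (fun s => r * cos s) (fun s => r * sin s));
    [apply is_Cderive_differentiable_snd|..]; assumption.
Qed.

(** The last derivative is only required to extend continuously: that it is
holomorphic would need Cauchy's formula, and demanding it would break the induction
from [g] to [z * g']. *)
Fixpoint disc_smooth (p : nat) (g : C -> C) : Prop :=
  (exists G, continuous_extension unit_disc closed_unit_disc g G) /\
  match p with
  | O => True
  | S q => exists g', (forall z, unit_disc z -> is_Cderive g z (g' z)) /\ disc_smooth q g'
  end.

Lemma unit_disc_open (z : C) :
  unit_disc z -> locally (T := AbsRing_UniformSpace C_AbsRing) z unit_disc.
Proof.
intros Hz; unfold unit_disc in *.
assert (Hd : 0 < 1 - Cmod z) by lra.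
exists (mkposreal _ Hd); intros w Hw.
assert (B : Cmod (w - z)%C < 1 - Cmod z) by exact Hw.
assert (T := Cmod_triangle (w - z)%C z).
assert (E : forall u v : C, (u - v + v)%C = u) by (intros; ring).
rewrite E in T; lra.
Qed.

Lemma is_Cderive_ext_disc (g h : C -> C) (z d : C) :
  (forall w, unit_disc w -> g w = h w) -> unit_disc z -> is_Cderive g z d -> is_Cderive h z d.
Proof.
intros E Hz; apply (is_derive_ext_loc (K := C_AbsRing) (V := C_NormedModule)).
generalize (unit_disc_open z Hz); apply filter_imp; exact E.
Qed.

Lemma nth_derivative_on_disc_ext (l : nat) (g h gl : C -> C) :
  (forall w, unit_disc w -> g w = h w) ->
  nth_derivative_on (K := C_AbsRing) (V := C_NormedModule) unit_disc l g gl ->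
  nth_derivative_on (K := C_AbsRing) (V := C_NormedModule) unit_disc l h gl.
Proof.
intros E; destruct l as [|l]; simpl.
- intros H z Hz; rewrite H, E by assumption; reflexivity.
- intros [g' [H1 H2]]; exists g'; split; [|exact H2].
  intros z Hz; apply (is_Cderive_ext_disc g); [exact E|exact Hz|apply H1, Hz].
Qed.

(** Each order l comes with its own chain of intermediate derivatives; uniqueness of the complex
    derivative merges them into a single chain starting from one g'. *)
Lemma disc_smooth_of_derivatives (p : nat) (g : C -> C) :
  (forall l, (l <= p)%nat -> exists gl Gl,
    nth_derivative_on (K := C_AbsRing) (V := C_NormedModule) unit_disc l g gl /\
    continuous_extension unit_disc closed_unit_disc gl Gl) ->
  disc_smooth p g.
Proof.
revert g; induction p as [|p IH]; intros g H.
- destruct (H O (le_n O)) as (g0 & G0 & H1 & H2 & H3); simpl in H1.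
  split; [|exact I]; exists G0; split; [exact H2|].
  intros z Hz; rewrite H3, H1 by assumption; reflexivity.
- split.
  { destruct (H O (Nat.le_0_l _)) as (g0 & G0 & H1 & H2 & H3); simpl in H1.
    exists G0; split; [exact H2|].
    intros z Hz; rewrite H3, H1 by assumption; reflexivity. }
  destruct (H 1%nat ltac:(lia)) as (_ & _ & (g' & Hg' & _) & _).
  exists g'; split; [exact Hg'|]; apply IH; intros l Hl.
  destruct (H (S l) ltac:(lia)) as (gl & Gl & (g'' & Hg'' & Hl'') & Hext).
  exists gl, Gl; split; [|exact Hext].
  apply (nth_derivative_on_disc_ext l g''); [|exact Hl''].
  intros z Hz; apply (is_Cderive_unique g z); [apply Hg'', Hz|apply Hg', Hz].
Qed.

Lemma disc_smooth_S (p : nat) (g : C -> C) : disc_smooth (S p) g -> disc_smooth p g.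
Proof.
revert g; induction p as [|p IH]; intros g [H1 (g' & H2 & H3)].
- split; [exact H1|exact I].
- split; [exact H1|]; exists g'; split; [exact H2|apply IH, H3].
Qed.

Lemma disc_smooth_plus (p : nat) (g h : C -> C) :
  disc_smooth p g -> disc_smooth p h -> disc_smooth p (fun z => g z + h z)%C.
Proof.
revert g h; induction p as [|p IH]; intros g h [(G & G1 & G2) Hg] [(H & H1 & H2) Hh];
  (split; [exists (fun z => G z + H z)%C; split;
    [apply continuous_on_Cplus; assumption|intros z Hz; rewrite G2, H2 by exact Hz; reflexivity]|]).
- exact I.
- destruct Hg as (g' & Hg1 & Hg2); destruct Hh as (h' & Hh1 & Hh2).
  exists (fun z => g' z + h' z)%C; split; [|apply IH; assumption].
  intros z Hz; apply is_Cderive_plus; [apply Hg1, Hz|apply Hh1, Hz].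
Qed.

(** Stated for all affine factors because the derivative of a * z + b is again affine, which closes
    the induction; the case needed is i z g'. *)
Lemma disc_smooth_affine (p : nat) (a b : C) (g : C -> C) :
  disc_smooth p g -> disc_smooth p (fun z => (a * z + b) * g z)%C.
Proof.
assert (Haff : forall a b, continuous_on closed_unit_disc (fun z => a * z + b)%C).
{ intros a' b'; apply continuous_on_Cplus; [|apply continuous_on_const].
  apply continuous_on_Cmult; [apply continuous_on_const|apply continuous_on_id]. }
revert a b g; induction p as [|p IH]; intros a b g H; assert (H' := H);
  destruct H' as [(G & G1 & G2) Hg];
  (split; [exists (fun z => (a * z + b) * G z)%C; split;
    [apply continuous_on_Cmult; [apply Haff|exact G1]
    |intros z Hz; rewrite G2 by exact Hz; reflexivity]|]).
- exact I.
- destruct Hg as (g' & Hg1 & Hg2).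
  exists (fun z => (0 * z + a) * g z + (a * z + b) * g' z)%C; split.
  + intros z Hz.
    apply (is_Cderive_mult (fun z => a * z + b)%C g); [|apply Hg1, Hz].
    replace (0 * z + a)%C with (0 * z + a * 1 + 0)%C by ring.
    apply (is_Cderive_plus (fun z => a * z)%C (fun _ => b)); [|apply is_Cderive_const].
    apply (is_Cderive_mult (fun _ => a) (fun z => z)); [apply is_Cderive_const|apply is_Cderive_id].
  + apply disc_smooth_plus; apply IH; [apply disc_smooth_S, H|exact Hg2].
Qed.

(** On a circle of radius r < 1 the t-derivative of g is i z g', so this is the fundamental theorem
    of calculus there; letting r tend to 1 uses only the continuity of both extensions. *)
Lemma disc_boundary_increment (g g' G G1 : C -> C) (a b : R) :
  (forall z, unit_disc z -> is_Cderive g z (g' z)) ->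
  continuous_extension unit_disc closed_unit_disc g G ->
  continuous_extension unit_disc closed_unit_disc (fun z => (Ci * z + 0) * g' z)%C G1 ->
  a <= b -> CRInt (fun t => G1 (circ 1 t)) a b = (G (circ 1 b) - G (circ 1 a))%C.
Proof.
intros Hg [HG1 HG2] [HH1 HH2] Hab.
apply Ceq_of_Cmod_le; intros eps Heps.
destruct (CRInt_disc_continuous G1 1 a b (eps / 3) HH1) as [d [Hd H]]; try lra.
assert (Hc : forall t, exists d, 0 < d /\ forall r, 1 - d < r <= 1 -> 0 <= r ->
  Cmod (G (circ r t) - G (circ 1 t))%C < eps / 3).
{ intros t.
  destruct (continuous_on_Cmod closed_unit_disc G (circ 1 t) (eps / 3) HG1) as [d1 [Hd1 H1]].
  - unfold closed_unit_disc; rewrite circ_Cmod; lra.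
  - lra.
  - exists d1; split; [exact Hd1|]; intros r Hr Hr0; apply H1.
    + unfold closed_unit_disc; rewrite circ_Cmod; lra.
    + replace (circ r t - circ 1 t)%C with (RtoC (r - 1) * circ 1 t)%C
        by (apply injective_projections; simpl; ring).
      rewrite Cmod_mult, circ_Cmod, Cmod_R, Rabs_minus_sym, Rabs_pos_eq by lra; lra. }
destruct (Hc a) as [da [Hda Ha]]; destruct (Hc b) as [db [Hdb Hb]].
set (r := Rmax (1 / 2) (1 - Rmin d (Rmin da db) / 2)).
assert (Hr : 1 / 2 <= r < 1 /\ 1 - d < r /\ 1 - da < r /\ 1 - db < r).
{ unfold r, Rmax, Rmin; repeat destruct Rle_dec; lra. }
specialize (H r ltac:(lra) ltac:(rewrite Rabs_minus_sym, Rabs_pos_eq; lra)).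
specialize (Ha r ltac:(lra) ltac:(lra)); specialize (Hb r ltac:(lra) ltac:(lra)).
assert (Hdisc : forall t, unit_disc (circ r t)).
{ intros t; unfold unit_disc; rewrite circ_Cmod; lra. }
rewrite (CRInt_derive (fun t => G (circ r t)) (fun t => G1 (circ r t))) in H.
- set (I1 := CRInt (fun t => G1 (circ 1 t)) a b) in *.
  replace (I1 - (G (circ 1 b) - G (circ 1 a)))%C with
    ((- (G (circ r b) - G (circ r a) - I1) + (G (circ r b) - G (circ 1 b)))
     + - (G (circ r a) - G (circ 1 a)))%C by ring.
  eapply Rle_trans; [apply Cmod_triangle|].
  assert (T := Cmod_triangle (- (G (circ r b) - G (circ r a) - I1)) (G (circ r b) - G (circ 1 b))).
  rewrite Cmod_opp in T |- *; lra.
- intros t; apply (is_RCderive_ext (fun s => g (circ r s))).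
  + intros s; symmetry; apply HG2, Hdisc.
  + rewrite HH2 by apply Hdisc.
    replace ((Ci * circ r t + 0) * g' (circ r t))%C with (Ci * circ r t * g' (circ r t))%C by ring.
    apply is_RCderive_along_circ, Hg, Hdisc.
- apply Ccontinuous_disc; [exact HH1|lra].
Qed.

Lemma is_RCderive_of_increments (F f : R -> C) :
  Ccontinuous f -> (forall a b, a <= b -> CRInt f a b = (F b - F a)%C) ->
  forall t, is_RCderive F t (f t).
Proof.
intros Hf H t.
(* Increments are known only from left to right, so the base point is put to the left of a
   neighbourhood of t. *)
set (a := t - 1).
assert (E : forall s, a < s -> (F a + CRInt f a s)%C = F s).
{ intros s Hs; rewrite H by lra; ring. }
assert (HI : is_RCderive (fun s => CRInt f a s) t (f t)).
{ apply (is_derive_RInt (V := C_R_NormedModule) f _ a).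
  - apply filter_forall; intros s; apply is_RInt_CRInt, Hf.
  - apply (proj2 (continuous_Ccontinuous f) Hf). }
apply (is_derive_ext_loc (V := C_R_NormedModule) (fun s => F a + CRInt f a s)%C).
- exists (mkposreal 1 Rlt_0_1); intros s Hs; apply E.
  apply Rabs_lt_between in Hs; change (minus s t) with (s - t) in Hs; simpl in Hs; unfold a; lra.
- replace (f t) with (0 + f t)%C by ring.
  apply is_RCderive_plus; [|exact HI].
  apply (is_derive_const (V := C_R_NormedModule)).
Qed.

(** Differentiating the boundary function of g in t yields the boundary function of i z g', which is
    smooth of one order less: the induction replaces g by i z g'. *)
Lemma disc_smooth_boundary (p : nat) (g G : C -> C) :
  disc_smooth p g -> continuous_extension unit_disc closed_unit_disc g G ->
  exists k, nth_derivative_on (K := R_AbsRing) (V := C_R_NormedModule) (fun _ => True) p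
    (fun t => G (circ 1 t)) k /\ Ccontinuous k.
Proof.
revert g G; induction p as [|p IH]; intros g G [_ Hg] HG.
- exists (fun t => G (circ 1 t)); split; [intros t _; reflexivity|].
  apply Ccontinuous_disc; [apply HG|lra].
- destruct Hg as (g' & Hg1 & Hg2).
  assert (Hh := disc_smooth_affine p Ci 0 g' Hg2).
  assert (exists G1, continuous_extension unit_disc closed_unit_disc (fun z => (Ci * z + 0) * g' z)%C G1)
    as [G1 HG1] by (destruct p; apply Hh).
  destruct (IH _ _ Hh HG1) as [k [Hk1 Hk2]].
  exists k; split; [|exact Hk2]; exists (fun t => G1 (circ 1 t)); split; [|exact Hk1].
  intros t _; apply (is_RCderive_of_increments (fun t => G (circ 1 t)) (fun t => G1 (circ 1 t))).
  + apply Ccontinuous_disc; [apply HG1|lra].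
  + intros a b Hab; apply (disc_boundary_increment g g'); assumption.
Qed.

(** * Fourier conditions and the Poisson kernel *)

Notation RC_derivative p f k :=
  (nth_derivative_on (K := R_AbsRing) (V := C_R_NormedModule) (fun _ => True) p f k).

Lemma RC_derivative_ext (p : nat) (f g k : R -> C) :
  (forall t, f t = g t) -> RC_derivative p f k -> RC_derivative p g k.
Proof.
intros E; destruct p as [|p]; simpl.
- intros H t Ht; rewrite <- E; apply H, Ht.
- intros [f' [Hf Hk]]; exists f'; split; [|exact Hk].
  intros t Ht; apply (is_RCderive_ext f); [exact E|apply Hf, Ht].
Qed.

Lemma RC_derivative_continuous (p : nat) (f k : R -> C) :
  RC_derivative p f k -> Ccontinuous k -> Ccontinuous f.
Proof.
destruct p as [|p]; simpl.
- intros H; apply Ccontinuous_ext; intros t; apply H; exact I.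
- intros [f' [H _]] _; apply (is_RCderive_continuous f f'); intros t; apply H; exact I.
Qed.

Lemma RC_derivative_minus (p : nat) (f g k l : R -> C) :
  RC_derivative p f k -> RC_derivative p g l ->
  RC_derivative p (fun t => f t - g t)%C (fun t => k t - l t)%C.
Proof.
revert f g; induction p as [|p IH]; simpl; intros f g.
- intros H1 H2 t Ht; rewrite H1, H2 by exact Ht; reflexivity.
- intros [f' [Hf Hk]] [g' [Hg Hl]].
  exists (fun t => f' t - g' t)%C; split; [|apply IH; assumption].
  intros t Ht; apply (is_derive_minus (V := C_R_NormedModule)); [apply Hf, Ht|apply Hg, Ht].
Qed.

Lemma is_RCderive_periodic (f f' : R -> C) (T : R) :
  (forall t, is_RCderive f t (f' t)) -> (forall t, f (t + T) = f t) ->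
  forall t, f' (t + T) = f' t.
Proof.
intros Hf Hp t; apply (is_RCderive_unique f t); [|apply Hf].
apply (is_RCderive_ext (fun s => f (s + T))); [exact Hp|].
assert (H := is_derive_comp (K := R_AbsRing) (V := C_R_NormedModule) f (fun s => s + T)
  t _ 1 (Hf (t + T))).
rewrite (scal_one (V := C_R_NormedModule)) in H; apply H.
auto_derive; trivial.
Qed.

(** Integration by parts against an exponential w with w' = c w: boundary terms cancel by
    periodicity, and each derivative multiplies the pairing by - c, so zero stays zero. *)
Lemma RC_derivative_orthogonal (p : nat) (f k w : R -> C) (c : C) :
  RC_derivative p f k -> Ccontinuous k -> (forall t, f (t + 2 * PI) = f t) ->
  (forall t, is_RCderive w t (c * w t)%C) -> w PI = w (- PI) ->
  CRInt (fun t => f t * w t)%C (- PI) PI = 0 ->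
  CRInt (fun t => k t * w t)%C (- PI) PI = 0.
Proof.
intros H Hk Hp Hw Hwp; revert f H Hp.
induction p as [|p IH]; simpl; intros f H Hp H0.
- rewrite <- H0; apply CRInt_ext; intros t; rewrite H by exact I; reflexivity.
- destruct H as [f' [Hf Hf']].
  assert (Hd : forall t, is_RCderive f t (f' t)) by (intros t; apply Hf; exact I).
  apply (IH f' Hf' (is_RCderive_periodic f f' _ Hd Hp)).
  assert (Cw : Ccontinuous w) by exact (is_RCderive_continuous _ _ Hw).
  assert (Ccw : Ccontinuous (fun t => c * w t)%C)
    by (apply Ccontinuous_mult; [apply Ccontinuous_const|exact Cw]).
  assert (Cf : Ccontinuous f) by exact (is_RCderive_continuous _ _ Hd).
  assert (Cf' := RC_derivative_continuous _ _ _ Hf' Hk).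
  assert (E := CRInt_derive (fun t => f t * w t)%C (fun t => f' t * w t + f t * (c * w t))%C
    (- PI) PI (fun t => is_RCderive_mult _ _ _ _ _ (Hd t) (Hw t))).
  assert (Hfp : f PI = f (- PI)).
  { rewrite <- (Hp (- PI)); f_equal; ring. }
  cbv beta in E; rewrite Hfp, Hwp, CRInt_plus in E.
  + rewrite (CRInt_ext (fun t => f t * (c * w t))%C (fun t => c * (f t * w t))%C) in E
      by (intros; ring).
    rewrite CRInt_scal, H0 in E by (apply Ccontinuous_mult; assumption).
    replace (CRInt (fun t => f' t * w t)%C (- PI) PI) with
      (CRInt (fun t => f' t * w t)%C (- PI) PI + c * 0)%C by ring.
    rewrite E; [ring|].
    apply Ccontinuous_plus; apply Ccontinuous_mult; assumption.
  + apply Ccontinuous_mult; assumption.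
  + apply Ccontinuous_mult; assumption.
Qed.

Lemma is_RCderive_exponential_pow (w : R -> C) (c : C) (n : nat) :
  (forall t, is_RCderive w t (c * w t)%C) ->
  forall t, is_RCderive (fun s => w s ^ n)%C t (RtoC (INR n) * c * w t ^ n)%C.
Proof.
intros Hw t; induction n as [|n IH].
- replace (RtoC (INR 0) * c * w t ^ 0)%C with (RtoC 0) by (simpl; ring).
  exact (is_derive_const (K := R_AbsRing) (V := C_R_NormedModule) (RtoC 1) t).
- rewrite S_INR, RtoC_plus.
  replace ((INR n + 1) * c * w t ^ S n)%C with
    ((c * w t) * w t ^ n + w t * (INR n * c * w t ^ n))%C by (simpl; ring).
  apply (is_RCderive_mult w (fun s => w s ^ n)%C); [apply Hw|exact IH].
Qed.

Lemma Ccontinuous_bounded (f : R -> C) (a b : R) :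
  a <= b -> Ccontinuous f -> exists M, forall t, a <= t <= b -> Cmod (f t) <= M.
Proof.
intros Hab Hf.
assert (Hn : forall t, continuous (fun s => fst (f s) * fst (f s) + snd (f s) * snd (f s)) t).
{ intros t; destruct (Hf t); apply (continuous_plus (V := R_NormedModule));
    apply (continuous_mult (K := R_AbsRing)); assumption. }
destruct (continuity_ab_maj _ a b Hab (fun t _ => proj2 (continuity_pt_filterlim _ t) (Hn t)))
  as [m [Hm _]].
exists (sqrt (fst (f m) * fst (f m) + snd (f m) * snd (f m))); intros t Ht.
unfold Cmod; simpl; rewrite 2 Rmult_1_r; apply sqrt_le_1_alt, (Hm t Ht).
Qed.

(** Formally 1 / (1 - q) is the sum of the q^n. Peeling off finitely many terms and bounding the
    remainder avoids exchanging a series with the integral. *)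
Lemma geometric_orthogonality (f q : R -> C) (r : R) :
  Ccontinuous f -> Ccontinuous q -> 0 <= r < 1 ->
  (forall t, Cmod (q t) <= r) ->
  (forall n, CRInt (fun t => f t * q t ^ n)%C (- PI) PI = 0) ->
  CRInt (fun t => f t * / (1 - q t))%C (- PI) PI = 0.
Proof.
intros Hf Hq Hr Hqr H0.
assert (HPI := PI_RGT_0).
destruct (Ccontinuous_bounded f (- PI) PI ltac:(lra) Hf) as [M HM].
assert (Hlow : forall t, 1 - r <= Cmod (1 - q t)%C).
{ intros t; assert (T := Cmod_triangle (1 - q t) (q t)).
  replace (1 - q t + q t)%C with (RtoC 1) in T by ring.
  rewrite Cmod_1 in T; specialize (Hqr t); lra. }
assert (Hne : forall t, (1 - q t)%C <> 0).
{ intros t; apply Cmod_gt_0; specialize (Hlow t); lra. }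
assert (C1q : Ccontinuous (fun t => 1 - q t)%C).
{ apply (Ccontinuous_ext (fun t => 1 + - (1) * q t)%C); [intros; ring|].
  apply Ccontinuous_plus; [apply Ccontinuous_const|].
  apply Ccontinuous_mult; [apply Ccontinuous_const|exact Hq]. }
assert (Cinv : Ccontinuous (fun t => / (1 - q t))%C) by (apply Ccontinuous_inv; assumption).
assert (Cfq : Ccontinuous (fun t => f t * / (1 - q t))%C) by (apply Ccontinuous_mult; assumption).
(* The identity 1 / (1 - q) = 1 + q / (1 - q), iterated n times; every term peeled off integrates to
   zero. *)
assert (Htail : forall n, CRInt (fun t => f t * / (1 - q t))%C (- PI) PI =
  CRInt (fun t => f t * / (1 - q t) * q t ^ n)%C (- PI) PI).
{ induction n as [|n IH].
  - apply CRInt_ext; intros t; simpl; ring.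
  - rewrite IH.
    rewrite (CRInt_ext _ (fun t => f t * q t ^ n + f t * / (1 - q t) * q t ^ S n)%C).
    + rewrite CRInt_plus, H0; [ring| |].
      * apply Ccontinuous_mult; [exact Hf|apply Ccontinuous_pow, Hq].
      * apply Ccontinuous_mult; [exact Cfq|apply Ccontinuous_pow, Hq].
    + intros t; simpl; field; apply Hne. }
apply Ceq_of_Cmod_le; intros eps Heps.
assert (HM0 : 0 <= M).
{ eapply Rle_trans; [apply Cmod_ge_0|apply (HM 0); lra]. }
set (B := 2 * PI * (M * / (1 - r))).
assert (HB : 0 <= B).
{ unfold B; apply Rmult_le_pos; [lra|]; apply Rmult_le_pos; [exact HM0|].
  left; apply Rinv_0_lt_compat; lra. }
destruct (pow_lt_1_zero r ltac:(rewrite Rabs_pos_eq; lra) (eps / (B + 1))) as [N HN];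
  [apply Rdiv_lt_0_compat; lra|].
specialize (HN N (le_n N)); rewrite Rabs_pos_eq in HN by (apply pow_le; lra).
rewrite (Htail N).
replace (CRInt (fun t => f t * / (1 - q t) * q t ^ N) (- PI) PI - 0)%C
  with (CRInt (fun t => f t * / (1 - q t) * q t ^ N)%C (- PI) PI) by ring.
eapply Rle_trans; [apply (Cmod_CRInt_le_const _ (M * / (1 - r) * r ^ N)); [lra| |]|].
- apply Ccontinuous_mult; [exact Cfq|apply Ccontinuous_pow, Hq].
- intros t Ht; rewrite 2 Cmod_mult, Cmod_inv, Cmod_pow by apply Hne.
  apply Rmult_le_compat.
  + apply Rmult_le_pos; [apply Cmod_ge_0|left; apply Rinv_0_lt_compat].
    specialize (Hlow t); lra.
  + apply pow_le, Cmod_ge_0.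
  + apply Rmult_le_compat; [apply Cmod_ge_0|left; apply Rinv_0_lt_compat|apply HM, Ht|].
    * specialize (Hlow t); lra.
    * apply Rinv_le_contravar; [lra|apply Hlow].
  + apply pow_incr; split; [apply Cmod_ge_0|apply Hqr].
- replace ((PI - - PI) * (M * / (1 - r) * r ^ N)) with (B * r ^ N) by (unfold B; ring).
  assert (0 <= r ^ N) by (apply pow_le; lra).
  apply Rle_trans with ((B + 1) * (eps / (B + 1))); [|right; field; lra].
  apply Rmult_le_compat; lra.
Qed.

Lemma CRInt_circ_pow (n : nat) : CRInt (fun t => circ 1 t ^ S n)%C (- PI) PI = 0.
Proof.
rewrite (disc_mean_value (fun z => z ^ S n)%C); [simpl; ring| |].
- apply continuous_on_Cpow, continuous_on_id.
- intros z _; apply (Cdifferentiable_pow (fun z => z)); exists (RtoC 1); apply is_Cderive_id.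
Qed.

Lemma circ_scal (r t : R) : circ r t = (RtoC r * circ 1 t)%C.
Proof. apply injective_projections; simpl; ring. Qed.

Lemma CRInt_circ_geometric (r : R) :
  0 <= r < 1 -> CRInt (fun t => circ r t * / (1 - circ r t))%C (- PI) PI = 0.
Proof.
intros Hr; apply (geometric_orthogonality _ _ r); try apply Ccontinuous_circ; try assumption.
- intros t; rewrite circ_Cmod by lra; lra.
- intros n.
  rewrite (CRInt_ext _ (fun t => RtoC r ^ S n * circ 1 t ^ S n)%C).
  + rewrite CRInt_scal, CRInt_circ_pow; [ring|].
    apply Ccontinuous_pow, Ccontinuous_circ.
  + intros t; rewrite <- Cpow_mult_l, <- circ_scal; reflexivity.
Qed.

Definition poisson (r t : R) : R := (1 - r * r) / (1 - 2 * r * cos t + r * r).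

(** The denominator is (1 - r)^2 + 2 r (1 - cos t), also equal to |1 - r e^(it)|^2. *)
Lemma poisson_denominator_pos (r t : R) : 0 <= r < 1 -> 0 < 1 - 2 * r * cos t + r * r.
Proof.
intros Hr; assert (B := COS_bound t); assert (0 <= r * (1 - cos t)) by (apply Rmult_le_pos; lra).
nra.
Qed.

Lemma circ_neq_1 (r t : R) : 0 <= r < 1 -> (1 - circ r t)%C <> 0.
Proof.
intros Hr E; assert (C1 : circ r t = RtoC 1).
{ replace (circ r t) with (RtoC 1 - (1 - circ r t))%C by ring; rewrite E; ring. }
assert (C2 := circ_Cmod r t ltac:(lra)); rewrite C1, Cmod_1 in C2; lra.
Qed.

Lemma circ_conj_neq_1 (r t : R) : 0 <= r < 1 -> (1 - Cconj (circ r t))%C <> 0.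
Proof.
intros Hr E; apply (circ_neq_1 r (- t) Hr); rewrite <- E; unfold circ, Cconj; simpl.
rewrite cos_neg, sin_neg; do 2 f_equal; ring.
Qed.

(** The series of r^|n| e^(int) split by the sign of n; the term n = 0 goes with the conjugate
    half. *)
Lemma poisson_decomposition (r t : R) :
  0 <= r < 1 ->
  RtoC (poisson r t) = (/ (1 - Cconj (circ r t)) + circ r t * / (1 - circ r t))%C.
Proof.
intros Hr.
assert (E : (circ r t * Cconj (circ r t))%C = RtoC (r * r)).
{ apply injective_projections; simpl; [|ring].
  replace (r * cos t * (r * cos t) - r * sin t * - (r * sin t))
    with (r * r * (Rsqr (sin t) + Rsqr (cos t))) by (unfold Rsqr; ring).
  rewrite sin2_cos2; ring. }
assert (E2 : (circ r t + Cconj (circ r t))%C = RtoC (2 * r * cos t)).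
{ apply injective_projections; simpl; ring. }
assert (N1 := circ_neq_1 r t Hr); assert (N2 := circ_conj_neq_1 r t Hr).
assert (N3 := poisson_denominator_pos r t Hr).
unfold poisson; rewrite RtoC_div by lra.
rewrite RtoC_plus, 2 RtoC_minus, <- E, <- E2.
replace (1 - (circ r t + Cconj (circ r t)) + circ r t * Cconj (circ r t))%C
  with ((1 - Cconj (circ r t)) * (1 - circ r t))%C by ring.
field; split; assumption.
Qed.

Lemma poisson_continuous (r : R) : 0 <= r < 1 -> forall t, continuous (poisson r) t.
Proof.
intros Hr t; apply (ex_derive_continuous (V := R_NormedModule)); unfold poisson; auto_derive.
assert (P := poisson_denominator_pos r t Hr); lra.
Qed.

Lemma Ccontinuous_inv_conj_circ (r : R) :
  0 <= r < 1 -> Ccontinuous (fun t => / (1 - Cconj (circ r t)))%C.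
Proof.
intros Hr; apply Ccontinuous_inv; [|intros t; apply circ_conj_neq_1, Hr].
apply (Ccontinuous_ext (fun t => 1 + - (1) * Cconj (circ r t))%C); [intros; ring|].
apply Ccontinuous_plus; [apply Ccontinuous_const|].
apply Ccontinuous_mult; [apply Ccontinuous_const|apply Ccontinuous_conj, Ccontinuous_circ].
Qed.

Lemma Ccontinuous_circ_geometric (r : R) :
  0 <= r < 1 -> Ccontinuous (fun t => circ r t * / (1 - circ r t))%C.
Proof.
intros Hr; apply Ccontinuous_mult; [apply Ccontinuous_circ|].
apply Ccontinuous_inv; [|intros t; apply circ_neq_1, Hr].
apply (Ccontinuous_ext (fun t => 1 + - (1) * circ r t)%C); [intros; ring|].
apply Ccontinuous_plus; [apply Ccontinuous_const|].
apply Ccontinuous_mult; [apply Ccontinuous_const|apply Ccontinuous_circ].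
Qed.

Lemma RInt_poisson (r : R) : 0 <= r < 1 -> RInt (poisson r) (- PI) PI = 2 * PI.
Proof.
intros Hr.
assert (G := Ccontinuous_circ_geometric r Hr).
assert (E : CRInt (fun t => RtoC (poisson r t)) (- PI) PI = RtoC (2 * PI)).
(* Writing the kernel as 1 + conj V + V with V = q / (1 - q), only the constant 1 has a nonzero
   integral. *)
{ rewrite (CRInt_ext _ (fun t => (RtoC 1 + Cconj (circ r t * / (1 - circ r t)))
    + circ r t * / (1 - circ r t))%C).
  - rewrite 2 CRInt_plus, CRInt_conj, CRInt_circ_geometric, CRInt_const; try assumption.
    + apply injective_projections; simpl; ring.
    + apply Ccontinuous_const.
    + apply Ccontinuous_conj, G.
    + apply Ccontinuous_plus; [apply Ccontinuous_const|apply Ccontinuous_conj, G].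
  - intros t; rewrite poisson_decomposition by exact Hr; f_equal.
    rewrite Cmult_conj, Cinv_conj by (apply circ_neq_1, Hr).
    rewrite Cminus_conj.
    replace (Cconj 1) with (RtoC 1) by (apply injective_projections; simpl; ring).
    field; apply circ_conj_neq_1, Hr. }
exact (f_equal fst E).
Qed.

(** The exponent [S n] for k and [n] for u - k leave the constant mode to k. This matches the two
    halves of the Poisson kernel: the one containing n = 0 annihilates u - k, the one starting at n
    = 1 annihilates k. *)
Lemma conjugate_poisson_bound (u : R -> R) (k : R -> C) (M r : R) :
  (forall t, continuous u t) -> Ccontinuous k -> 0 <= r < 1 ->
  (forall t, - PI <= t <= PI -> Cmod (k t) <= M) ->
  (forall n, CRInt (fun t => k t * circ 1 t ^ S n)%C (- PI) PI = 0) ->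
  (forall n, CRInt (fun t => (RtoC (u t) - k t) * Cconj (circ 1 t) ^ n)%C (- PI) PI = 0) ->
  Rabs (RInt (fun t => u t * (r * sin t / (1 - 2 * r * cos t + r * r))) (- PI) PI) <= 2 * PI * M.
Proof.
intros Hu Hk Hr HM Hk0 Hh0.
assert (HPI := PI_RGT_0).
assert (Cu := Ccontinuous_RtoC u Hu).
assert (Ch : Ccontinuous (fun t => RtoC (u t) - k t)%C).
{ apply (Ccontinuous_ext (fun t => RtoC (u t) + - (1) * k t)%C); [intros; ring|].
  apply Ccontinuous_plus; [exact Cu|].
  apply Ccontinuous_mult; [apply Ccontinuous_const|exact Hk]. }
assert (CW := Ccontinuous_inv_conj_circ r Hr).
assert (CV := Ccontinuous_circ_geometric r Hr).
assert (CP := Ccontinuous_RtoC _ (poisson_continuous r Hr)).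
assert (HhW : CRInt (fun t => (RtoC (u t) - k t) * / (1 - Cconj (circ r t)))%C (- PI) PI = 0).
{ apply (geometric_orthogonality _ _ r Ch (Ccontinuous_conj _ (Ccontinuous_circ r)) Hr).
  - intros t; rewrite Cmod_conj, circ_Cmod; lra.
  - intros n.
    rewrite (CRInt_ext _ (fun t => RtoC r ^ n * ((RtoC (u t) - k t) * Cconj (circ 1 t) ^ n))%C).
    + rewrite CRInt_scal, Hh0; [ring|].
      apply Ccontinuous_mult; [exact Ch|apply Ccontinuous_pow, Ccontinuous_conj, Ccontinuous_circ].
    + intros t; rewrite (circ_scal r), Cmult_conj, Cpow_mult_l.
      replace (Cconj r) with (RtoC r) by (apply injective_projections; simpl; ring); ring. }
assert (HkV : CRInt (fun t => k t * (circ r t * / (1 - circ r t)))%C (- PI) PI = 0).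
{ rewrite (CRInt_ext _ (fun t => k t * circ r t * / (1 - circ r t))%C) by (intros; ring).
  apply (geometric_orthogonality (fun t => k t * circ r t)%C (circ r) r);
    [|apply Ccontinuous_circ|exact Hr|..].
  - apply Ccontinuous_mult; [exact Hk|apply Ccontinuous_circ].
  - intros t; rewrite circ_Cmod; lra.
  - intros n.
    rewrite (CRInt_ext _ (fun t => RtoC r ^ S n * (k t * circ 1 t ^ S n))%C).
    + rewrite CRInt_scal, Hk0; [ring|].
      apply Ccontinuous_mult; [exact Hk|apply Ccontinuous_pow, Ccontinuous_circ].
    + intros t; rewrite (circ_scal r), Cpow_mult_l; simpl; ring. }
assert (HuW : CRInt (fun t => RtoC (u t) * / (1 - Cconj (circ r t)))%C (- PI) PI =
  CRInt (fun t => k t * RtoC (poisson r t))%C (- PI) PI).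
{ rewrite (CRInt_ext (fun t => k t * RtoC (poisson r t))%C
    (fun t => k t * / (1 - Cconj (circ r t)) + k t * (circ r t * / (1 - circ r t)))%C)
    by (intros t; rewrite poisson_decomposition by exact Hr; ring).
  rewrite CRInt_plus, HkV, Cplus_0_r by (apply Ccontinuous_mult; assumption).
  rewrite (CRInt_ext _ (fun t => (RtoC (u t) - k t) * / (1 - Cconj (circ r t))
    + k t * / (1 - Cconj (circ r t)))%C) by (intros; ring).
  rewrite CRInt_plus, HhW, Cplus_0_l by (apply Ccontinuous_mult; assumption); reflexivity. }
(* The kernel is nonnegative of total mass 2 PI, which gives a bound independent of r. *)
assert (HkP : Cmod (CRInt (fun t => k t * RtoC (poisson r t))%C (- PI) PI) <= 2 * PI * M).
{ replace (2 * PI * M) with (RInt (fun t => M * poisson r t) (- PI) PI).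
  - apply Cmod_CRInt_le; [lra|apply Ccontinuous_mult; assumption| |].
    + apply (ex_RInt_scal (V := R_NormedModule)), (ex_RInt_continuous (V := R_CompleteNormedModule)).
      intros t _; apply poisson_continuous, Hr.
    + intros t Ht; rewrite Cmod_mult, Cmod_R, Rabs_pos_eq.
      * apply Rmult_le_compat_r; [|apply HM, Ht].
        apply Rmult_le_pos; [nra|left; apply Rinv_0_lt_compat, poisson_denominator_pos, Hr].
      * apply Rmult_le_pos; [nra|left; apply Rinv_0_lt_compat, poisson_denominator_pos, Hr].
  - rewrite <- (RInt_poisson r Hr), Rmult_comm.
    apply (RInt_scal (V := R_CompleteNormedModule) (poisson r)).
    apply (ex_RInt_continuous (V := R_CompleteNormedModule)).
    intros t _; apply poisson_continuous, Hr. }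
rewrite <- HuW in HkP.
assert (B := Rle_trans _ _ _ (Rabs_snd_le_Cmod _) HkP); simpl in B.
rewrite <- Rabs_Ropp.
replace (- RInt (fun t => u t * (r * sin t / (1 - 2 * r * cos t + r * r))) (- PI) PI)
  with (snd (CRInt (fun t => RtoC (u t) * / (1 - Cconj (circ r t)))%C (- PI) PI)); [exact B|].
assert (Hint : ex_RInt (fun t => u t * (r * sin t / (1 - 2 * r * cos t + r * r))) (- PI) PI).
{ apply (ex_RInt_continuous (V := R_CompleteNormedModule)); intros t _.
  apply (continuous_mult (K := R_AbsRing)); [apply Hu|].
  apply (ex_derive_continuous (V := R_NormedModule)); auto_derive.
  assert (P := poisson_denominator_pos r t Hr); lra. }
transitivity (RInt (fun t => - (u t * (r * sin t / (1 - 2 * r * cos t + r * r)))) (- PI) PI);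
  [|exact (RInt_opp (V := R_CompleteNormedModule) _ _ _ Hint)].
apply RInt_ext; intros t _; simpl.
assert (P := poisson_denominator_pos r t Hr).
(* |1 - conj q|^2 in the unfolded shape in which [Cinv] produces it. *)
assert (D : (1 + - (r * cos t)) * ((1 + - (r * cos t)) * 1) +
  (0 + - - (r * sin t)) * ((0 + - - (r * sin t)) * 1) = 1 - 2 * r * cos t + r * r).
{ replace (1 - 2 * r * cos t + r * r) with
    (1 - 2 * r * cos t + r * r * (Rsqr (sin t) + Rsqr (cos t))) by (rewrite sin2_cos2; ring).
  unfold Rsqr; ring. }
rewrite D; field; lra.
Qed.

(** * The counterexample *)

(** The value 0 for s <= 0 is the limit at 0 from the right, so this is continuous up to s = 1; the
    pole at s = exp 1 stays out of reach of sine values. *)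
Definition inv_log (s : R) : R := if Rlt_dec 0 s then / (1 - ln s) else 0.

Lemma inv_log_pos (s : R) : 0 < s -> inv_log s = / (1 - ln s).
Proof. intros Hs; unfold inv_log; destruct Rlt_dec; [reflexivity|lra]. Qed.

Lemma inv_log_nonpos (s : R) : s <= 0 -> inv_log s = 0.
Proof. intros Hs; unfold inv_log; destruct Rlt_dec; [lra|reflexivity]. Qed.

Lemma ln_nonpos (s : R) : 0 < s <= 1 -> ln s <= 0.
Proof. intros Hs; rewrite <- ln_1; apply ln_le; lra. Qed.

Lemma inv_log_ge_0 (s : R) : s <= 1 -> 0 <= inv_log s.
Proof.
intros Hs; unfold inv_log; destruct Rlt_dec as [H|]; [|lra].
assert (L := ln_nonpos s ltac:(lra)); left; apply Rinv_0_lt_compat; lra.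
Qed.

Lemma inv_log_continuous (s : R) : s <= 1 -> continuous inv_log s.
Proof.
intros Hs; destruct (Rtotal_order s 0) as [H|[H|H]].
- apply (continuous_ext_loc _ (fun _ => 0)); [|apply continuous_const].
  assert (Hd : 0 < - s) by lra.
  exists (mkposreal _ Hd); intros y Hy; symmetry; apply inv_log_nonpos.
  apply Rabs_lt_between in Hy; change (minus y s) with (y - s) in Hy; simpl in Hy; lra.
- subst s; apply continuity_pt_filterlim; intros eps Heps.
  (* Solves 1 / (1 - ln d) = eps; the cap at 1 keeps the logarithm nonpositive. *)
  set (d := Rmin 1 (exp (1 - / eps))).
  exists d; split; [apply Rmin_pos; [lra|apply exp_pos]|].
  intros y [_ Hy]; simpl in Hy |- *; unfold R_dist in *; rewrite (inv_log_nonpos 0), Rminus_0_r by lra.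
  rewrite Rminus_0_r in Hy.
  destruct (Rlt_dec 0 y) as [Hy0|Hy0]; [|rewrite inv_log_nonpos, Rabs_R0; lra].
  rewrite Rabs_pos_eq in Hy by lra.
  assert (Hy1 : y < 1) by (eapply Rlt_le_trans; [exact Hy|apply Rmin_l]).
  assert (Hy2 : y < exp (1 - / eps)) by (eapply Rlt_le_trans; [exact Hy|apply Rmin_r]).
  rewrite Rabs_pos_eq by (apply inv_log_ge_0; lra).
  rewrite inv_log_pos by exact Hy0.
  apply ln_increasing in Hy2; [|exact Hy0]; rewrite ln_exp in Hy2.
  rewrite <- (Rinv_inv eps); apply Rinv_lt_contravar; [|lra].
  assert (0 < / eps) by (apply Rinv_0_lt_compat; lra).
  apply Rmult_lt_0_compat; lra.
- apply (continuous_ext_loc _ (fun s => / (1 - ln s))).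
  + exists (mkposreal _ H); intros y Hy; symmetry; apply inv_log_pos.
    apply Rabs_lt_between in Hy; change (minus y s) with (y - s) in Hy; simpl in Hy; lra.
  + assert (L := ln_nonpos s ltac:(lra)).
    apply (ex_derive_continuous (V := R_NormedModule)); auto_derive; repeat split; lra.
Qed.

(** Equal to sign (sin t) / (1 - ln |sin t|): at most one of the two terms is nonzero, and oddness
    and the period 2 PI come for free from those of the sine. *)
Definition log_cusp (t : R) : R := inv_log (sin t) - inv_log (- sin t).

Lemma log_cusp_continuous (t : R) : continuous log_cusp t.
Proof.
assert (B := SIN_bound t).
apply (continuous_minus (V := R_NormedModule)).
- apply (continuous_comp sin inv_log); [apply continuous_sin|apply inv_log_continuous; lra].
- apply (continuous_comp (fun s => - sin s) inv_log); [|apply inv_log_continuous; lra].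
  apply (continuous_opp (V := R_NormedModule)), continuous_sin.
Qed.

Lemma log_cusp_periodic (t : R) : log_cusp (t + 2 * PI) = log_cusp t.
Proof.
unfold log_cusp; replace (sin (t + 2 * PI)) with (sin t); [reflexivity|].
rewrite sin_plus, sin_2PI, cos_2PI; ring.
Qed.

Lemma RInt_log_cusp : RInt log_cusp (- PI) PI = 0.
Proof.
assert (Hc : forall a b, ex_RInt log_cusp a b).
{ intros a b; apply (ex_RInt_continuous (V := R_CompleteNormedModule)).
  intros; apply log_cusp_continuous. }
(* Substituting - t for t: by oddness the integral equals its own opposite. *)
assert (E : is_RInt (V := R_NormedModule) log_cusp (- PI) PI (RInt log_cusp PI (- PI))).
{ apply (is_RInt_ext (V := R_NormedModule) (fun t => opp (log_cusp (- t)))).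
  - intros t _; unfold log_cusp, opp; simpl; rewrite sin_neg, Ropp_involutive.
    apply Ropp_minus_distr.
  - apply (is_RInt_comp_opp (V := R_NormedModule) log_cusp); rewrite Ropp_involutive.
    apply (RInt_correct (V := R_CompleteNormedModule)), Hc. }
apply (is_RInt_unique (V := R_CompleteNormedModule)) in E.
rewrite <- (opp_RInt_swap (V := R_CompleteNormedModule) log_cusp (- PI) PI) in E by apply Hc.
change (RInt log_cusp (- PI) PI = - RInt log_cusp (- PI) PI) in E; lra.
Qed.

Lemma log_cusp_mult_sin_ge_0 (t : R) : 0 <= log_cusp t * sin t.
Proof.
assert (B := SIN_bound t); unfold log_cusp; destruct (Rle_dec 0 (sin t)) as [H|H].
- rewrite (inv_log_nonpos (- sin t)) by lra; rewrite Rminus_0_r.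
  apply Rmult_le_pos; [apply inv_log_ge_0|]; lra.
- rewrite (inv_log_nonpos (sin t)) by lra.
  assert (P := inv_log_ge_0 (- sin t) ltac:(lra)); nra.
Qed.

(** The integrand is nonnegative, so it suffices to integrate from d to PI / 2, where sin t >= 1 -
    r. There the denominator is at most 3 sin^2 t, and the resulting minorant has an elementary
    antiderivative. *)
Lemma conjugate_log_cusp_lower_bound (r : R) :
  0 < r < 1 ->
  r / 3 * ln (1 - ln (1 - r)) <=
  RInt (fun t => log_cusp t * (r * sin t / (1 - 2 * r * cos t + r * r))) (- PI) PI.
Proof.
intros Hr.
set (F := fun t => log_cusp t * (r * sin t / (1 - 2 * r * cos t + r * r))).
assert (HF0 : forall t, 0 <= F t).
{ intros t; unfold F.
  assert (P := poisson_denominator_pos r t ltac:(lra)).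
  replace (log_cusp t * (r * sin t / (1 - 2 * r * cos t + r * r))) with
    (log_cusp t * sin t * (r / (1 - 2 * r * cos t + r * r))) by (field; lra).
  apply Rmult_le_pos; [apply log_cusp_mult_sin_ge_0|].
  left; apply Rdiv_lt_0_compat; lra. }
assert (HFc : forall t, continuous F t).
{ intros t; apply (continuous_mult (K := R_AbsRing)); [apply log_cusp_continuous|].
  apply (ex_derive_continuous (V := R_NormedModule)); auto_derive.
  assert (P := poisson_denominator_pos r t ltac:(lra)); lra. }
assert (HFi : forall a b, ex_RInt F a b).
{ intros a b; apply (ex_RInt_continuous (V := R_CompleteNormedModule)); intros; apply HFc. }
assert (HPI := PI_RGT_0).
set (d := asin (1 - r)).
assert (Hsd : sin d = 1 - r) by (apply sin_asin; lra).
assert (Hd : 0 < d < PI / 2).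
{ assert (B := asin_bound_lt (1 - r) ltac:(lra)); fold d in B.
  split; [|apply B]; apply Rnot_le_lt; intros Hd.
  assert (S := sin_ge_0 (- d) ltac:(lra) ltac:(lra)); rewrite sin_neg in S; lra. }
rewrite <- (RInt_Rplus_Chasles F (- PI) d PI), <- (RInt_Rplus_Chasles F d (PI / 2) PI) by apply HFi.
assert (I1 : 0 <= RInt F (- PI) d) by (apply RInt_ge_0; [lra|apply HFi|intros; apply HF0]).
assert (I3 : 0 <= RInt F (PI / 2) PI) by (apply RInt_ge_0; [lra|apply HFi|intros; apply HF0]).
enough (I2 : r / 3 * ln (1 - ln (1 - r)) <= RInt F d (PI / 2)) by lra.
assert (Hsin : forall t, d <= t <= PI / 2 -> 1 - r <= sin t <= 1).
{ intros t Ht; split; [|apply SIN_bound].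
  rewrite <- Hsd; apply sin_incr_1; lra. }
set (A := fun t => r / 3 * - ln (1 - ln (sin t))).
(* The extra factor cos t, at most 1, makes the minorant the exact derivative of [A]. *)
set (A' := fun t => r / 3 * (cos t / (sin t * (1 - ln (sin t))))).
assert (HA : is_RInt (V := R_NormedModule) A' d (PI / 2) (minus (A (PI / 2)) (A d))).
{ apply (is_RInt_derive (V := R_CompleteNormedModule)); rewrite Rmin_left, Rmax_right by lra;
    intros t Ht; specialize (Hsin t Ht); assert (L := ln_nonpos (sin t) ltac:(lra)).
  - unfold A, A'; auto_derive; [repeat split; lra|field; split; lra].
  - unfold A'; apply (ex_derive_continuous (V := R_NormedModule)); auto_derive.
    split; [lra|]; split; [|exact I]; apply Rmult_integral_contrapositive; split; lra. }
replace (r / 3 * ln (1 - ln (1 - r))) with (RInt A' d (PI / 2)).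
- apply RInt_le; [lra|exists (minus (A (PI / 2)) (A d)); exact HA|apply HFi|].
  intros t Ht; specialize (Hsin t ltac:(lra)); assert (L := ln_nonpos (sin t) ltac:(lra)).
  assert (P := poisson_denominator_pos r t ltac:(lra)).
  unfold F, log_cusp, A'; rewrite inv_log_pos, inv_log_nonpos, Rminus_0_r by lra.
  assert (Hcos : 0 <= cos t <= 1) by (split; [apply cos_ge_0; lra|apply COS_bound]).
  (* The constant 3: the left side is (1 - r)^2 + 2 r (1 - cos t), with 1 - r <= sin t, r < 1, and 1
     - cos t <= 1 - cos^2 t since 0 <= cos t <= 1. *)
  assert (HP : 1 - 2 * r * cos t + r * r <= 3 * (sin t * sin t)).
  { assert (S := sin2_cos2 t); unfold Rsqr in S.
    assert (S2 : (1 - r) * (1 - r) <= sin t * sin t) by nra.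
    assert (S3 : 1 - cos t <= sin t * sin t) by nra.
    nra. }
  assert (HL : 0 < / (1 - ln (sin t))) by (apply Rinv_0_lt_compat; lra).
  replace (r / 3 * (cos t / (sin t * (1 - ln (sin t))))) with
    (/ (1 - ln (sin t)) * (r * sin t * (cos t / (3 * (sin t * sin t))))) by (field; split; lra).
  apply Rmult_le_compat_l; [lra|].
  apply Rmult_le_compat_l; [nra|].
  apply Rle_trans with (1 / (3 * (sin t * sin t))).
  + apply Rmult_le_compat_r; [left; apply Rinv_0_lt_compat; nra|lra].
  + unfold Rdiv; rewrite Rmult_1_l; apply Rinv_le_contravar; assumption.
- apply (is_RInt_unique (V := R_CompleteNormedModule)) in HA; rewrite HA; unfold A, minus, plus, opp; simpl.
  rewrite sin_PI2, Hsd, ln_1, Rminus_0_r, ln_1; ring.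
Qed.

Lemma conjugate_log_cusp_unbounded (M : R) :
  exists r, 0 < r < 1 /\
  M < Rabs (RInt (fun t => log_cusp t * (r * sin t / (1 - 2 * r * cos t + r * r))) (- PI) PI).
Proof.
(* With 1 - r = exp (1 - exp B) the double logarithm equals B. As B >= 1 forces r >= 1/2, the lower
   bound is at least B / 6, which exceeds |M|. *)
set (B := 6 * Rabs M + 1).
assert (HB : 1 <= B) by (unfold B; assert (P := Rabs_pos M); lra).
assert (E1 := exp_ineq1_le B).
assert (E2 := exp_ineq1_le 1).
assert (E3 : exp (1 - exp B) <= 1 / 2).
{ apply Rle_trans with (exp (- (1))).
  - destruct (Req_dec (exp B) 2) as [->|]; [right; f_equal; ring|].
    left; apply exp_increasing; lra.
  - rewrite exp_Ropp; apply Rle_trans with (/ 2); [apply Rinv_le_contravar; lra|lra]. }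
assert (E4 := exp_pos (1 - exp B)).
exists (1 - exp (1 - exp B)); split; [lra|].
eapply Rlt_le_trans; [|apply Rle_abs].
eapply Rlt_le_trans; [|apply conjugate_log_cusp_lower_bound; lra].
replace (1 - (1 - exp (1 - exp B))) with (exp (1 - exp B)) by ring.
rewrite ln_exp; replace (1 - (1 - exp B)) with (exp B) by ring; rewrite ln_exp.
assert (M <= Rabs M) by apply Rle_abs.
assert (0 <= Rabs M) by apply Rabs_pos.
unfold B in *; nra.
Qed.

(** * Periodic antiderivatives and functions on the circle *)

Lemma exists_periodic_antiderivative (v : R -> R) :
  (forall t, continuous v t) -> (forall t, v (t + 2 * PI) = v t) -> RInt v (- PI) PI = 0 ->
  exists V, (forall t, is_derive V t (v t)) /\ (forall t, V (t + 2 * PI) = V t) /\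
    RInt V (- PI) PI = 0.
Proof.
intros Hc Hp H0.
assert (HPI := PI_RGT_0).
assert (Hi : forall a b, ex_RInt v a b).
{ intros a b; apply (ex_RInt_continuous (V := R_CompleteNormedModule)); intros; apply Hc. }
set (V0 := RInt v 0).
assert (HV0 : forall t, is_derive V0 t (v t)).
{ intros t; apply (is_derive_RInt (V := R_CompleteNormedModule) v V0 0); [|apply Hc].
  apply filter_forall; intros s; apply (RInt_correct (V := R_CompleteNormedModule)), Hi. }
assert (HV0i : ex_RInt V0 (- PI) PI).
{ apply (ex_RInt_continuous (V := R_CompleteNormedModule)); intros t _.
  apply (ex_derive_continuous (V := R_NormedModule)); exists (v t); apply HV0. }
(* Subtracting the mean makes V of mean zero again, so that the construction can be repeated. *)
set (m := RInt V0 (- PI) PI / (2 * PI)).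
exists (fun t => V0 t - m); split; [|split].
- intros t; replace (v t) with (minus (v t) zero) by apply (minus_zero_r (G := R_AbelianGroup)).
  apply (is_derive_minus (V := R_NormedModule)); [apply HV0|].
  exact (is_derive_const (K := R_AbsRing) (V := R_NormedModule) m t).
(* The increment of V0 over a period is constant in t because v is periodic, and at t = - PI it is
   the integral of v over a period, which is zero. *)
- assert (Hd : forall t, is_derive (fun t => V0 (t + 2 * PI) - V0 t) t 0).
  { intros t; replace 0 with (minus (v (t + 2 * PI)) (v t))
      by (rewrite Hp; apply (minus_eq_zero (G := R_AbelianGroup))).
    apply (is_derive_minus (V := R_NormedModule)); [|apply HV0].
    assert (H := is_derive_comp (V := R_NormedModule) V0 (fun s => s + 2 * PI) t _ 1 (HV0 (t + 2 * PI))).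
    rewrite (scal_one (V := R_NormedModule)) in H; apply H; auto_derive; trivial. }
  assert (Hz : V0 (- PI + 2 * PI) - V0 (- PI) = 0).
  { replace (- PI + 2 * PI) with PI by ring; unfold V0.
    assert (S := RInt_Rplus_Chasles v 0 (- PI) PI (Hi _ _) (Hi _ _)); lra. }
  assert (Hconst : forall a b, a < b -> V0 (a + 2 * PI) - V0 a = V0 (b + 2 * PI) - V0 b).
  { intros a b Hab; apply (eq_is_derive (V := R_NormedModule) (fun t => V0 (t + 2 * PI) - V0 t) a b);
      [intros; apply Hd|exact Hab]. }
  intros t; destruct (Rtotal_order t (- PI)) as [L|[L|L]].
  + specialize (Hconst _ _ L); lra.
  + subst t; lra.
  + specialize (Hconst _ _ L); lra.
- rewrite (RInt_Rminus V0 (fun _ => m)) by (exact HV0i || apply ex_RInt_const).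
  rewrite (RInt_const (V := R_CompleteNormedModule)).
  change (RInt V0 (- PI) PI - (PI - - PI) * m = 0 :> R); unfold m; field; lra.
Qed.

Lemma exists_iterated_periodic_antiderivative (p : nat) (u : R -> R) :
  (forall t, continuous u t) -> (forall t, u (t + 2 * PI) = u t) -> RInt u (- PI) PI = 0 ->
  exists v, (forall t, v (t + 2 * PI) = v t) /\
    RC_derivative p (fun t => RtoC (v t)) (fun t => RtoC (u t)).
Proof.
intros Hc Hp H0.
(* Continuity and mean zero are carried along because the next antiderivative needs them. *)
enough (exists v, (forall t, continuous v t) /\ (forall t, v (t + 2 * PI) = v t) /\
  RInt v (- PI) PI = 0 /\ RC_derivative p (fun t => RtoC (v t)) (fun t => RtoC (u t)))
  as (v & _ & Hv1 & _ & Hv2) by (exists v; split; assumption).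
induction p as [|p (v & Hvc & Hvp & Hv0 & Hv)].
- exists u; split; [exact Hc|]; split; [exact Hp|]; split; [exact H0|].
  intros t _; reflexivity.
- destruct (exists_periodic_antiderivative v Hvc Hvp Hv0) as (V & HV & HVp & HV0).
  exists V; split; [|split; [exact HVp|split; [exact HV0|]]].
  + intros t; apply (ex_derive_continuous (V := R_NormedModule)); exists (v t); apply HV.
  + exists (fun t => RtoC (v t)); split; [|exact Hv].
    intros t _; apply is_RCderive_components; split; [apply HV|].
    exact (is_derive_const (K := R_AbsRing) (V := R_NormedModule) 0 t).
Qed.

(** Equality of the points gives cos (s - t) = 1, that is, sin ((s - t) / 2) = 0 by the half-angle
    formula. *)
Lemma expi_eq (s t : R) : expi s = expi t -> exists k : Z, s = t + 2 * IZR k * PI.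
Proof.
intros E; injection E as Ec Es.
assert (H : cos (2 * ((s - t) / 2)) = 1).
{ replace (2 * ((s - t) / 2)) with (s - t) by field.
  rewrite cos_minus, Ec, Es; assert (S := sin2_cos2 t); unfold Rsqr in S; lra. }
rewrite cos_2a_sin in H.
destruct (sin_eq_0_0 ((s - t) / 2)) as [k Hk]; [nra|].
exists k; lra.
Qed.

Lemma periodic_IZR (v : R -> R) (T : R) :
  (forall t, v (t + T) = v t) -> forall (k : Z) t, v (t + IZR k * T) = v t.
Proof.
intros Hv.
assert (Hn : forall (n : nat) t, v (t + INR n * T) = v t).
{ induction n as [|n IH]; intros t; [f_equal; simpl; ring|].
  rewrite S_INR; replace (t + (INR n + 1) * T) with (t + INR n * T + T) by ring.
  rewrite Hv; apply IH. }
intros k t; destruct (Z.le_gt_cases 0 k) as [H|H].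
- rewrite <- (Z2Nat.id k H), <- INR_IZR_INZ; apply Hn.
- rewrite <- (Hn (Z.to_nat (- k)) (t + IZR k * T)), INR_IZR_INZ, Z2Nat.id by lia.
  f_equal; rewrite opp_IZR; ring.
Qed.

(** [epsilon] picks some argument of z, and periodicity makes the choice immaterial. Off the circle
    no argument exists and the value is arbitrary. *)
Lemma exists_circle_function (v : R -> R) :
  (forall t, v (t + 2 * PI) = v t) ->
  exists f : C -> C, forall t, f (expi t) = RtoC (v t).
Proof.
intros Hv.
exists (fun z => RtoC (v (epsilon (inhabits 0) (fun s => expi s = z)))); intros t; f_equal.
assert (E := epsilon_spec (inhabits 0) (fun s => expi s = expi t) (ex_intro _ t eq_refl)).
simpl in E; destruct (expi_eq _ _ E) as [k ->].
replace (2 * IZR k * PI) with (IZR k * (2 * PI)) by ring.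
apply periodic_IZR, Hv.
Qed.

(** * Vanishing Fourier coefficients of the two boundary functions *)

Lemma exterior_open (z : C) :
  exterior z -> locally (T := AbsRing_UniformSpace C_AbsRing) z exterior.
Proof.
intros Hz; unfold exterior in *.
assert (Hd : 0 < Cmod z - 1) by lra.
exists (mkposreal _ Hd); intros w Hw.
assert (B : Cmod (w - z)%C < Cmod z - 1) by exact Hw.
assert (T := Cmod_triangle (- (w - z))%C w).
assert (E : forall u v : C, (- (u - v) + u)%C = v) by (intros; ring).
rewrite E, Cmod_opp in T; lra.
Qed.

Lemma Cdifferentiable_extension (U W : C -> Prop) (f F : C -> C) (z : C) :
  locally (T := AbsRing_UniformSpace C_AbsRing) z U -> continuous_extension U W f F ->
  ex_derive (K := C_AbsRing) (V := C_NormedModule) f z -> Cdifferentiable F z.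
Proof.
intros HU [_ HF] [d Hd]; exists d; revert Hd.
apply (is_derive_ext_loc (K := C_AbsRing) (V := C_NormedModule)).
revert HU; apply filter_imp; intros w Hw; symmetry; apply HF, Hw.
Qed.

Lemma continuous_on_Cinv (D : C -> Prop) :
  (forall z, D z -> z <> 0) -> continuous_on D Cinv.
Proof.
intros H0 z Hz P HP.
assert (L := ex_derive_continuous (K := C_AbsRing) (V := C_NormedModule) Cinv z
  (ex_intro _ _ (is_Cderive_inv z (H0 z Hz))) P HP).
apply locally_C in L; change (locally z (fun w => D w -> P (/ w)%C)).
revert L; apply filter_imp; intros w Hw _; exact Hw.
Qed.

(** The mean value property for G z^(n+1), which vanishes at 0; the exponent starts at 1 because the
    mean of G itself need not be zero. *)
Lemma disc_orthogonality (g G : C -> C) (n : nat) :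
  holomorphic_on unit_disc g -> continuous_extension unit_disc closed_unit_disc g G ->
  CRInt (fun t => G (circ 1 t) * circ 1 t ^ S n)%C (- PI) PI = 0.
Proof.
intros Hg HG.
rewrite (disc_mean_value (fun z => G z * z ^ S n)%C).
- simpl; ring.
- apply continuous_on_Cmult; [apply HG|apply continuous_on_Cpow, continuous_on_id].
- intros z Hz; apply (Cdifferentiable_mult G (fun z => z ^ S n)%C).
  + apply (Cdifferentiable_extension unit_disc closed_unit_disc g);
      [apply unit_disc_open, Hz|exact HG|apply Hg, Hz].
  + apply (Cdifferentiable_pow (fun z => z)); exists (RtoC 1); apply is_Cderive_id.
Qed.

Lemma Cinv_circ (t : R) : (/ circ 1 t)%C = Cconj (circ 1 t).
Proof.
assert (S := sin2_cos2 t); unfold Rsqr in S.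
apply injective_projections; simpl;
  replace (1 * cos t * (1 * cos t * 1) + 1 * sin t * (1 * sin t * 1)) with 1 by lra; field.
Qed.

(** On the circle conj z = 1 / z, so the integrand extends to H z^(-n), holomorphic outside the
    disc. It vanishes at infinity even for n = 0, thanks to the normalization of h there. *)
Lemma exterior_orthogonality (h H : C -> C) (n : nat) :
  holomorphic_on exterior h -> lim_infty_zero h ->
  continuous_extension exterior closed_exterior h H ->
  CRInt (fun t => H (circ 1 t) * Cconj (circ 1 t) ^ n)%C (- PI) PI = 0.
Proof.
intros Hh Hlim HH.
assert (N0 : forall z, closed_exterior z -> z <> 0).
{ intros z Hz; apply Cmod_gt_0; unfold closed_exterior in Hz; lra. }
rewrite (CRInt_ext _ (fun t => H (circ 1 t) * (/ circ 1 t) ^ n)%C)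
  by (intros t; rewrite Cinv_circ; reflexivity).
apply (exterior_mean_value (fun z => H z * (/ z) ^ n)%C).
- apply continuous_on_Cmult; [apply HH|].
  apply (continuous_on_Cpow closed_exterior Cinv), continuous_on_Cinv, N0.
- intros z Hz; apply (Cdifferentiable_mult H (fun z => (/ z) ^ n)%C).
  + apply (Cdifferentiable_extension exterior closed_exterior h);
      [apply exterior_open, Hz|exact HH|apply Hh, Hz].
  + apply (Cdifferentiable_pow Cinv); eexists; apply is_Cderive_inv, N0.
    unfold exterior in Hz; unfold closed_exterior; lra.
- intros eps Heps; destruct (Hlim eps Heps) as [M HM].
  exists (Rmax 1 M); intros z Hz.
  assert (Hz1 : 1 < Cmod z) by (eapply Rle_lt_trans; [apply Rmax_l|exact Hz]).
  assert (Hz2 : M < Cmod z) by (eapply Rle_lt_trans; [apply Rmax_r|exact Hz]).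
  rewrite (proj2 HH) by exact Hz1.
  eapply Rle_lt_trans; [|apply HM, Hz2].
  rewrite Cmod_mult, Cmod_pow, Cmod_inv by (apply Cmod_gt_0; lra).
  rewrite <- (Rmult_1_r (Cmod (h z))) at 2.
  apply Rmult_le_compat_l; [apply Cmod_ge_0|].
  rewrite <- (pow1 n); apply pow_incr; split; [left; apply Rinv_0_lt_compat; lra|].
  rewrite <- Rinv_1; apply Rinv_le_contravar; lra.
Qed.

Lemma expi_circ (t : R) : expi t = circ 1 t.
Proof. apply injective_projections; simpl; ring. Qed.

Lemma circ_periodic (r t : R) : circ r (t + 2 * PI) = circ r t.
Proof.
unfold circ; rewrite cos_plus, sin_plus, sin_2PI, cos_2PI.
apply injective_projections; simpl; ring.
Qed.

Lemma is_RCderive_conj (f : R -> C) (t : R) (l : C) :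
  is_RCderive f t l -> is_RCderive (fun s => Cconj (f s)) t (Cconj l).
Proof.
rewrite 2 is_RCderive_components; intros [H1 H2]; split; [exact H1|].
apply (is_derive_opp (V := R_NormedModule) _ _ _ H2).
Qed.

Theorem theorem10 : forall p : nat,
  exists f : C -> C,
    Cp_circle p f /\
    ~ (exists g h : C -> C,
         Ap_disc p g /\ A0p_exterior p h /\
         exists G H : C -> C,
           continuous_extension unit_disc closed_unit_disc g G /\
           continuous_extension exterior closed_exterior h H /\
           forall z : C, unit_circle z -> f z = Cplus (G z) (H z)).
Proof.
intros p.
assert (HPI := PI_RGT_0).
destruct (exists_iterated_periodic_antiderivative p log_cusp log_cusp_continuous
  log_cusp_periodic RInt_log_cusp) as (v & Hvp & Hv).
destruct (exists_circle_function v Hvp) as [f Hf].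
assert (Cu := Ccontinuous_RtoC _ log_cusp_continuous).
exists f; split.
{ exists (fun t => RtoC (log_cusp t)); split.
  - apply (RC_derivative_ext p (fun t => RtoC (v t))); [|exact Hv].
    intros t; symmetry; apply Hf.
  - apply continuous_Ccontinuous, Cu. }
intros (g & h & [Hg Hgp] & [[Hh _] Hlim] & G & H & HG & HH & HfGH).
destruct (disc_smooth_boundary p g G (disc_smooth_of_derivatives p g Hgp) HG) as (k & HGk & Ck).
assert (HGper : forall t, G (circ 1 (t + 2 * PI)) = G (circ 1 t)).
{ intros t; rewrite circ_periodic; reflexivity. }
assert (Ch : Ccontinuous (fun t => RtoC (log_cusp t) - k t)%C).
{ apply (Ccontinuous_ext (fun t => RtoC (log_cusp t) + - (1) * k t)%C); [intros; ring|].
  apply Ccontinuous_plus; [exact Cu|].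
  apply Ccontinuous_mult; [apply Ccontinuous_const|exact Ck]. }
destruct (Ccontinuous_bounded k (- PI) PI ltac:(lra) Ck) as [M HM].
(* The target is exactly the bound that [conjugate_poisson_bound] gives for every r, hence the
   contradiction. *)
destruct (conjugate_log_cusp_unbounded (2 * PI * M)) as (r & Hr & Hbig).
apply (Rlt_not_le _ _ Hbig).
assert (Hcirc : circ 1 PI = circ 1 (- PI)).
{ rewrite <- (circ_periodic 1 (- PI)); f_equal; ring. }
apply (conjugate_poisson_bound log_cusp k); try assumption;
  [apply log_cusp_continuous|lra|..]; intros n.
(* The weight e^(i(n+1)t) tests the coefficient of index - (n + 1), first of G and then of its p-th
   derivative k. *)
- apply (RC_derivative_orthogonal p (fun t => G (circ 1 t)) k _ (RtoC (INR (S n)) * Ci)%C);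
    try assumption.
  + apply (is_RCderive_exponential_pow (circ 1) Ci), is_RCderive_circ.
  + rewrite Hcirc; reflexivity.
  + apply (disc_orthogonality g); assumption.
(* On the circle v - G is H, whose coefficients of index n >= 0 vanish; this passes to its p-th
   derivative [log_cusp - k]. *)
- apply (RC_derivative_orthogonal p (fun t => RtoC (v t) - G (circ 1 t))%C _ _
    (RtoC (INR n) * - Ci)%C).
  + apply RC_derivative_minus; assumption.
  + exact Ch.
  + intros t; rewrite Hvp, HGper; reflexivity.
  + apply (is_RCderive_exponential_pow (fun t => Cconj (circ 1 t)) (- Ci)); intros t.
    replace (- Ci * Cconj (circ 1 t))%C with (Cconj (Ci * circ 1 t))
      by (apply injective_projections; simpl; ring).
    apply is_RCderive_conj, is_RCderive_circ.
  + rewrite Hcirc; reflexivity.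
  + rewrite (CRInt_ext _ (fun t => H (circ 1 t) * Cconj (circ 1 t) ^ n)%C).
    * apply (exterior_orthogonality h); assumption.
    * intros t; rewrite <- Hf, expi_circ, HfGH; [ring|].
      unfold unit_circle; apply circ_Cmod; lra.
Qed.
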